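(* Let $R>0$, and for each $n$ let $\mathcal P_{b,n}$ be a collection of distributions $\mathbb P_n$ (as described in the context) whose means satisfy $|\sqrt n\beta_n^{(k)}|<R$ for all $k\in[d]$ and all $n\in\mathbb N$, and such that $$\sup_n\sup_{\mathbb P_n\in\mathcal P_{b,n}}\mathbb E_{\mathbb P_n}\big[|\mathrm e_{1,n}^{(j)}|^3\big]<\infty .$$ Then $$\lim_n\sup_{\mathbb P_n\in\mathcal P_{b,n}}\widetilde{R}_n^{(l)}=0\quad\text{for } l\in\{1,2\},$$ and, as a result, $$\lim_n\sup_{\mathbb P_n\in\mathcal P_{b,n}}\Big|\widetilde{\mathbb E}_{\mathbb P_n}\big[H\circ P^{(j)}(\mathcal Z_n^{(j)};\sqrt n\beta_n^{(j)})\big]-\widetilde{\mathbb E}_{\mathcal N}\big[H\circ P^{(j)}(\mathcal Z_n^{(j)};\sqrt n\beta_n^{(j)})\big]\Big|=0 .$$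
   Context: Fix $d\in\mathbb N$ and $\rho\in(0,1)$; $[d]=\{1,\dots,d\}$; $x^{(k)}$ is the $k$-th component of $x\in\mathbb R^d$. For each $n$, $\zeta_{1,n},\dots,\zeta_{n,n}$ are i.i.d. $\mathbb R^d$-valued with law $\mathbb P_n$, mean $\beta_n=\mathbb E_{\mathbb P_n}[\zeta_{1,n}]$ and covariance matrix $\Sigma=I_{d,d}$; $V_n=n^{-1/2}\sum_{i=1}^n\zeta_{i,n}$ is assumed to have a Lebesgue density. Put $\mathrm e_{i,n}=\zeta_{i,n}-\beta_n$ and $\mathcal Z_n=\sum_{i=1}^n n^{-1/2}\mathrm e_{i,n}=V_n-\sqrt n\beta_n$. $\mathbb E_{\mathbb P_n}$ is expectation under $\mathbb P_n$; $\mathbb E_{\mathcal N}$ is expectation when $\mathcal Z_n\sim\mathcal N(0_d,I_{d,d})$. $\phi,\Phi$ are the standard normal density and CDF, $\bar\Phi=1-\Phi$. Coordinate $k$ is selected if $V_n^{(k)}+W_n^{(k)}>0$, where $W_n\sim\mathcal N(0_d,\rho^2I_{d,d})$ is independent of $V_n$; $j$ is a fixed selected index. The univariate pivot in terms of the standardized variable is $$P^{(j)}(z;b)=\frac{\int_z^\infty\phi(v)\,\bar\Phi(-(v+b)/\rho)\,dv}{\int_{-\infty}^\infty\phi(v)\,\bar\Phi(-(v+b)/\rho)\,dv},\qquad z,b\in\mathbb R .$$ $H:\mathbb R\to\mathbb R$ is an arbitrary fixed $C^3$ function that is bounded and has bounded derivatives up to third order. Define $$\widetilde G_1(z;b)=\bar\Phi(-(z+b)/\rho),\qquad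 \widetilde G_2(z;b)=\bar\Phi(-(z+b)/\rho)\, H(P^{(j)}(z;b)),$$ $$\widetilde D_n=\mathbb E_{\mathcal N}\big[\bar\Phi(-(\mathcal Z_n^{(j)}+\sqrt n\beta_n^{(j)})/\rho)\big],$$ $$\widetilde R_n^{(l)}=\widetilde D_n^{-1}\Big|\mathbb E_{\mathbb P_n}[\widetilde G_l(\mathcal Z_n^{(j)};\sqrt n\beta_n^{(j)})]-\mathbb E_{\mathcal N}[\widetilde G_l(\mathcal Z_n^{(j)};\sqrt n\beta_n^{(j)})]\Big|,\quad l\in\{1,2\}.$$ The expectation conditional on selection is, for measurable $\mathcal Q:\mathbb R\to\mathbb R$, $$\widetilde{\mathbb E}_{\mathbb P_n}[\mathcal Q(\mathcal Z_n^{(j)})]=\frac{\mathbb E_{\mathbb P_n}\big[\mathcal Q(\mathcal Z_n^{(j)})\,\bar\Phi(-(\mathcal Z_n^{(j)}+\sqrt n\beta_n^{(j)})/\rho)\big]}{\mathbb E_{\mathbb P_n}\big[\bar\Phi(-(\mathcal Z_n^{(j)}+\sqrt n\beta_n^{(j)})/\rho)\big]},$$ and $\widetilde{\mathbb E}_{\mathcal N}$ is the same expression with $\mathbb E_{\mathbb P_n}$ replaced by $\mathbb E_{\mathcal N}$. *)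

(* Defs.v *)
From HB Require Import structures.
From mathcomp Require Import all_boot all_order all_algebra.
From mathcomp Require Import all_classical all_reals all_analysis.
Import Order.TTheory GRing.Theory Num.Theory.
Import numFieldNormedType.Exports.

Set Implicit Arguments.
Unset Strict Implicit.
Unset Printing Implicit Defensive.

Local Open Scope classical_set_scope.
Local Open Scope ring_scope.

(* MathComp-Analysis. [R^d] is rendered by [d]-tuples with the product
   sigma-algebra; components are taken in [measurableTypeR R], i.e. [R] with the
   Borel structure that carries [lebesgue_measure] and [normal_prob]. *)
Notation Rvec R d := (d.-tuple (measurableTypeR R)).

Lemma product_sigma_finite d1 d2 (T1 : measurableType d1)
    (T2 : measurableType d2) (R : realType)
    (m1 : {sigma_finite_measure set T1 -> \bar R})
    (m2 : {sigma_finite_measure set T2 -> \bar R}) :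
  sigma_finite setT (m1 \x m2)%E.
Proof.
have /sigma_finiteP[F [TF ndF Foo]] := sigma_finiteT m1.
have /sigma_finiteP[G [TG ndG Goo]] := sigma_finiteT m2.
exists (fun n => F n `*` G n).
  rewrite -setXTT TF TG predeqE => -[x y]; split.
    move=> [/= [n _ Fnx] [k _ Gky]]; exists (maxn n k) => //; split.
    - by move: x Fnx; exact/subsetPset/ndF/leq_maxl.
    - by move: y Gky; exact/subsetPset/ndG/leq_maxr.
  by move=> [n _ []/= ? ?]; split; exists n.
move=> k; have [? ?] := Foo k; have [? ?] := Goo k.
split; first exact: measurableX.
by rewrite product_measure1E// lte_mul_pinfty// ge0_fin_numE.
Qed.

Section power_measure.
Context d (T : measurableType d) (R : realType).

Definition tcons n (x : T * n.-tuple T) : n.+1.-tuple T :=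
  [tuple of x.1 :: x.2].

Lemma measurable_tcons n : measurable_fun [set: T * n.-tuple T] (@tcons n).
Proof. by apply: measurable_cons. Qed.

HB.instance Definition _ n := isMeasurableFun.Build _ _ _ _ (@tcons n)
  (@measurable_tcons n).

Definition untcons n (t : n.+1.-tuple T) : T * n.-tuple T :=
  (thead t, [tuple of behead t]).

Lemma tconsK n : cancel (@tcons n) (@untcons n).
Proof.
by case=> x t; rewrite /untcons /tcons/=; congr pair; apply/val_inj.
Qed.

Lemma measurable_untcons n : measurable_fun [set: n.+1.-tuple T] (@untcons n).
Proof.
apply/measurable_fun_pairP; split; first exact: measurable_tnth.
exact: measurable_behead.
Qed.

Section step.
Variables (mu : {sigma_finite_measure set T -> \bar R}) (n : nat).
Variable nu : {sigma_finite_measure set (n.-tuple T) -> \bar R}.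

Definition power_step : set (n.+1.-tuple T) -> \bar R :=
  pushforward (mu \x nu)%E (@tcons n).

Let power_step0 : power_step set0 = 0%E.
Proof. by rewrite /power_step /pushforward preimage_set0 measure0. Qed.

Let power_step_ge0 A : (0 <= power_step A)%E.
Proof. exact: measure_ge0. Qed.

Let power_step_sigma_additive : semi_sigma_additive power_step.
Proof.
move=> F mF tF mUF; rewrite /power_step /pushforward preimage_bigcup.
apply: measure_semi_sigma_additive.
- by move=> i; rewrite -[X in measurable X]setTI; exact: measurable_tcons.
- apply/trivIsetP => /= i k _ _ ik; rewrite -preimage_setI.
  by move/trivIsetP : tF => /(_ _ _ _ _ ik) ->//; rewrite preimage_set0.
- rewrite -preimage_bigcup -[X in measurable X]setTI.
  exact: measurable_tcons.
Qed.

HB.instance Definition _ := isMeasure.Build _ _ _ power_step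
  power_step0 power_step_ge0 power_step_sigma_additive.

Lemma power_step_sigma_finite : sigma_finite setT power_step.
Proof.
have [F FT mF] := product_sigma_finite mu nu.
exists (fun i => @untcons n @^-1` F i).
  by rewrite -preimage_bigcup -FT preimage_setT.
move=> i; have [mFi Foo] := mF i; split.
  by rewrite -[X in measurable X]setTI; exact: measurable_untcons.
rewrite /power_step /pushforward (_ : _ @^-1` _ = F i)//.
by apply/seteqP; split=> x /=; rewrite tconsK.
Qed.

HB.instance Definition _ := Measure_isSigmaFinite.Build _ _ _ power_step
  power_step_sigma_finite.

End step.

(* The [n]-fold product [mu \x ... \x mu], as a measure on [n]-tuples. *)
Fixpoint power_measure (mu : {sigma_finite_measure set T -> \bar R}) (n : nat)
    : {sigma_finite_measure set (n.-tuple T) -> \bar R} :=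
  match n with
  | 0 => (\d_ [tuple])%E
  | m.+1 => power_step mu (power_measure mu m)
  end.

End power_measure.

Definition lebesgue_tuple (R : realType) (d : nat) :
    {sigma_finite_measure set (Rvec R d) -> \bar R} :=
  power_measure (@lebesgue_measure R) d.

(* The law [N(0_d, I_d)]: independent standard normal components. *)
Definition std_gaussian (R : realType) (d : nat) :
    {sigma_finite_measure set (Rvec R d) -> \bar R} :=
  power_measure (@normal_prob R 0 1) d.

Section laws.
Context {R : realType} {d : nat}.
Implicit Types P : probability (Rvec R d) R.

Definition component (k : 'I_d) (x : Rvec R d) : R := tnth x k.

Definition mean P (k : 'I_d) : R := fine 'E_P[component k]%E.

(* The second moments are required to be finite, so that means and covariances
   are genuine. *)
Definition identity_covariance P :=
  (forall k, component k \in Lfun P 2%:E) /\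
  (forall k l, covariance P (component k) (component l) = ((k == l)%:R)%:E).

Definition third_moment P (j : 'I_d) : \bar R :=
  (\int[P]_x (`|component j x - mean P j| ^+ 3)%:E)%E.

End laws.

Section samples.
Context {R : realType} {d : nat} {dO : measure_display} {Om : measurableType dO}.
Variables (Q : probability Om R) (n : nat) (zeta : 'I_n -> Om -> Rvec R d).

Definition mutually_independent :=
  forall (J : {set 'I_n}) (A : 'I_n -> set (Rvec R d)),
    (forall i, measurable (A i)) ->
    Q (\bigcap_(i in [set i | i \in J]) (zeta i @^-1` A i)) =
    (\prod_(i in J) Q (zeta i @^-1` A i))%E.

Definition iid_sample (P : probability (Rvec R d) R) :=
  (forall i A, measurable A -> Q (zeta i @^-1` A) = P A) /\
  mutually_independent.

Definition V_ (w : Om) : Rvec R d :=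
  [tuple (Num.sqrt n%:R)^-1 * \sum_(i < n) tnth (zeta i w) k | k < d].

Definition Z_ (beta : 'I_d -> R) (w : Om) : Rvec R d :=
  [tuple \sum_(i < n) (Num.sqrt n%:R)^-1 * (tnth (zeta i w) k - beta k) | k < d].

Definition has_lebesgue_density (V : Om -> Rvec R d) :=
  exists p : Rvec R d -> R,
    [/\ measurable_fun setT p, forall x, 0 <= p x &
        forall A, measurable A ->
          Q (V @^-1` A) = (\int[lebesgue_tuple R d]_(x in A) (p x)%:E)%E].

End samples.

Section pivot.
Context {R : realType}.
Implicit Types (rho z b : R) (H : R -> R).

Definition Phi (x : R) : R := fine (normal_prob 0 1 `]-oo, x]).
Definition Phibar (x : R) : R := 1 - Phi x.

Definition pivot rho z b : R :=
  (\int[lebesgue_measure]_(v in `[z, +oo[)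
      (normal_pdf 0 1 v * Phibar (- (v + b) / rho))) /
  (\int[lebesgue_measure]_v (normal_pdf 0 1 v * Phibar (- (v + b) / rho))).

Definition G1 rho z b : R := Phibar (- (z + b) / rho).
Definition G2 rho H z b : R := Phibar (- (z + b) / rho) * H (pivot rho z b).

Definition C3_bounded H :=
  [/\ forall k, (k < 3)%N -> forall x, derivable (H^`(k))%classic x 1,
      continuous (H^`(3))%classic &
      exists M : R, forall k, (k <= 3)%N -> forall x, `|(H^`(k))%classic x| <= M].

End pivot.

Section selective.
Context {R : realType} {d : nat}.
Variables (j : 'I_d) (rho : R).

(* Expectation given selection, for the law of [Z] under [mu]. *)
Definition cond_expectation {dT} {T : measurableType dT}
    (mu : {measure set T -> \bar R}) (Z : T -> Rvec R d) (b : R)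
    (q : R -> R) : R :=
  (\int[mu]_w (q (tnth (Z w) j) * Phibar (- (tnth (Z w) j + b) / rho))) /
  (\int[mu]_w Phibar (- (tnth (Z w) j + b) / rho)).

Definition D_ (b : R) : R :=
  \int[std_gaussian R d]_z Phibar (- (tnth z j + b) / rho).

Definition remainder {dO} {Om : measurableType dO} (Q : probability Om R)
    (Z : Om -> Rvec R d) (b : R) (G : R -> R -> R) : R :=
  (D_ b)^-1 * `|\int[Q]_w G (tnth (Z w) j) b -
                \int[std_gaussian R d]_z G (tnth z j) b|.

Definition cond_discrepancy {dO} {Om : measurableType dO}
    (Q : probability Om R) (Z : Om -> Rvec R d) (b : R) (H : R -> R) : R :=
  `|cond_expectation Q Z b (fun z => H (pivot rho z b)) -
    cond_expectation (std_gaussian R d) id b (fun z => H (pivot rho z b))|.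

End selective.

(* Supremum in [[0, +oo]]: unlike [ereal_sup], it is [0] on the empty set. *)
Definition sup_nneg {R : realType} (A : set (\bar R)) : \bar R :=
  ereal_sup (A `|` [set 0%E]).

(* Main.v *)
From HB Require Import structures.
Require Import Defs.
From mathcomp Require Import all_boot all_order all_algebra.
From mathcomp Require Import all_classical all_reals all_analysis.
From mathcomp Require Import measurable_realfun ring lra.
Import Order.TTheory GRing.Theory Num.Theory.
Import numFieldNormedType.Exports.
Local Open Scope classical_set_scope.
Local Open Scope ring_scope.

(** The functions to be averaged depend on z through its j-th component, which
    under the law P_n is a normalized sum S of n independent real summands with
    mean 0, variance 1 / n and third absolute moment O(n^(-3/2)), and which is
    a standard normal variable N in the Gaussian model (integral_marginal). The
    whole theorem rests on a central limit theorem for S with a rate that is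
    uniform over the laws and over the test functions h with given bounds on
    |h| and |h'| (clt_rate): |E h(S) - E h(N)| <= C (2 m3 + 1) / sqrt n, where
    m3 bounds the third moments.

    This rate comes from Stein's method. Stein's equation f' - x f = h - E h(N)
    has a solution f such that f and f' are bounded and f' is Lipschitz, with
    constants depending on the bounds for h and h' alone (stein_solution).
    Evaluating it at S gives E h(S) - E h(N) = E [f'(S) - S f(S)] = sum_i E
    [f'(S) / n - X_i f(S)], and in each term f can be expanded at S - X_i,
    which is independent of X_i: the first two moments of X_i cancel against
    each other, and the third one controls the remainder (stein_summand).

    The rate applies to h = G1 and h = G2 for every b. The derivative of G1 is
    bounded by a constant depending on rho. That of G2 involves the derivative
    of the pivot, whose denominator is the Gaussian probability of selection
    D_n; this probability is increasing in b, so for b > - r it exceeds its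
    value delta > 0 at - r. The same delta bounds the factor 1 / D_n in the
    remainders, which are thus O(1 / sqrt n). Finally the conditional
    discrepancy is a difference of two ratios, and is at most R^(2) + sup |H|
    R^(1) (cond_discrepancy_le). *)

Set Implicit Arguments.
Unset Strict Implicit.
Unset Printing Implicit Defensive.

(** * The a priori bound for Stein's equation *)

Section normal_density.
Context {R : realType}.
Local Notation phi := (@normal_pdf R 0 1).

Lemma phiE x : phi x = normal_peak 1 * expR (- (x ^+ 2 / 2)).
Proof.
by rewrite normal_pdfE ?oner_eq0// /normal_fun subr0 expr1n mulNr.
Qed.

Lemma phi_gt0 x : 0 < phi x.
Proof. by rewrite phiE mulr_gt0 ?expR_gt0// normal_peak_gt0// oner_eq0. Qed.

Lemma phi_neq0 x : phi x != 0. Proof. by rewrite gt_eqF// phi_gt0. Qed.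

Lemma phi_even x : phi (- x) = phi x.
Proof. by rewrite !phiE sqrrN. Qed.

Lemma phi_le_peak x : phi x <= normal_peak 1.
Proof. by rewrite normal_pdf_ub// oner_eq0. Qed.

(** Since exp (x^2 / 2) >= 1 + x^2 / 2 >= |x|; this is what makes the density
    vanish at infinity. *)
Lemma normrM_phi_le x : `|x| * phi x <= normal_peak 1.
Proof.
rewrite phiE mulrCA ler_piMr ?normal_peak_ge0// expRN ler_pdivrMr ?expR_gt0//.
rewrite mul1r; apply: le_trans (expR_ge1Dx _).
rewrite -(real_normK (num_real x)); have := sqr_ge0 (`|x| - 1); lra.
Qed.

Lemma is_derive_phi (x : R) : is_derive x 1 phi (- (x * phi x)).
Proof.
have -> : phi = (fun x => normal_peak 1 * expR ((- 2^-1) *: (x ^+ 2))).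
  apply/funext => y; rewrite phiE; congr (_ * expR _).
  by rewrite /GRing.scale/=; ring.
by apply: is_derive_eq; rewrite /GRing.scale /=; field.
Qed.

Lemma phi_cvgy : phi x @[x --> +oo] --> (0 : R).
Proof.
apply/cvgr0Pnorm_le => e e0; near=> x.
have x0 : 0 < x by near: x; apply: nbhs_pinfty_gt.
rewrite ger0_norm ?normal_pdf_ge0// -(ler_pM2l x0).
have := normrM_phi_le x; rewrite gtr0_norm// => /le_trans; apply.
by rewrite -ler_pdivrMr//; near: x; apply: nbhs_pinfty_ge; rewrite num_real.
Unshelve. all: by end_near. Qed.

End normal_density.

Section stein_equation.
Context {R : realType}.
Local Notation phi := (@normal_pdf R 0 1).

Let derive_le0_noninc (f df : R -> R) (x y : R) : x <= y ->
  (forall z, x <= z -> is_derive z 1 f (df z)) ->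
  (forall z, x <= z -> df z <= 0) -> f y <= f x.
Proof.
move=> xy fE df0; rewrite -subr_le0.
have [||c + ->] := @MVT_segment R f df x y xy.
- by move=> z /[!in_itv]/= /andP[/ltW xz _]; exact: fE.
- apply: derivable_within_continuous => z /[!in_itv]/= /andP[xz _].
  by apply: ex_derive; exact: fE.
- by rewrite in_itv/= => /andP[xc _]; rewrite mulr_le0_ge0 ?subr_ge0// df0.
Qed.

(** The function phi y * (g y + K / y) is nonincreasing on the positive
    half-line: its derivative is phi y * (k y - K - K / y^2). As its first
    summand tends to 0 and its second one is nonnegative, it is nonnegative.
    This replaces the usual estimates of the Mills ratio. *)
Let stein_tail_lower (g k : R -> R) (K : R) :
  (forall x : R, is_derive x 1 g (x * g x + k x)) -> (forall x, `|k x| <= K) ->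
  phi x * g x @[x --> +oo] --> 0 -> forall x, 0 < x -> - K <= x * g x.
Proof.
move=> gE kK g0 x x0.
have K0 : 0 <= K by exact: le_trans (kK 0).
pose u y := phi y * (g y + K / y).
have uE (y : R) : x <= y ->
    is_derive y 1 u (phi y * (k y - K - K / y ^+ 2)).
  move=> xy; have y0 : y != 0 by rewrite gt_eqF// (lt_le_trans x0).
  have := gE y; have := is_derive_phi y => ? ?.
  have ? : is_derive y (1 : R) (fun z : R => K / z) (- (K / y ^+ 2)).
    have Vy := @is_deriveV _ id y 1 1 y0 (is_derive_id _ _).
    have := @is_deriveZ _ _ _ _ K _ _ _ Vy.
    by rewrite /GRing.scale/= mulr1 mulrN.
  have -> : u = phi * (g + (fun z : R => K / z)) by [].
  by apply: is_derive_eq; rewrite /GRing.scale /= !fctE; field.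
suff u0 : 0 <= u x.
  move: u0; rewrite /u pmulr_rge0 ?phi_gt0// -lerBlDr sub0r lerNl.
  by rewrite ler_pdivlMr// mulNr lerNl mulrC.
apply/ler_addgt0Pl => e e0.
move/cvgr0Pnorm_le : g0 => /(_ _ e0) => g0.
near (pinfty_nbhs R) => y.
have xy : x <= y by near: y; apply: nbhs_pinfty_ge; rewrite num_real.
have uyx : u y <= u x.
  apply: (@derive_le0_noninc u _ x y xy uE) => z xz.
  rewrite mulr_ge0_le0 ?normal_pdf_ge0// subr_le0.
  apply: (@le_trans _ _ 0); first by rewrite subr_le0 (le_trans (ler_norm _)).
  by rewrite divr_ge0// exprn_ge0// (le_trans _ xz)// ltW.
rewrite -lerBlDl sub0r; apply: le_trans uyx.
have : `|phi y * g y| <= e by near: y; exact: g0.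
rewrite ler_norml => /andP[+ _] => /le_trans; apply.
rewrite /u mulrDr lerDl mulr_ge0 ?normal_pdf_ge0// divr_ge0//.
Unshelve. all: by end_near. Qed.

Lemma stein_tail (g k : R -> R) (K : R) :
  (forall x : R, is_derive x 1 g (x * g x + k x)) -> (forall x, `|k x| <= K) ->
  phi x * g x @[x --> +oo] --> 0 -> forall x, 0 < x -> `|x * g x| <= K.
Proof.
move=> gE kK g0 x x0; rewrite ler_norml (@stein_tail_lower g k)//=.
rewrite -lerN2 -mulrN; apply: (@stein_tail_lower (- g) (- k)) => //.
- move=> y; have := gE y => ?; apply: is_derive_eq.
  by rewrite /= opprD mulrN.
- by move=> y; rewrite normrN.
- have -> : (fun x => phi x * (- g) x) = - (fun x => phi x * g x).
    by apply/funext => y; rewrite !fctE mulrN.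
  by have := cvgN g0; rewrite oppr0; exact.
Qed.

(** The a priori estimate behind all bounds on Stein solutions: any solution of
    g' = x g + k that is o(1 / phi) at both ends satisfies |x g| <= sup |k|,
    hence |g'| <= 2 sup |k|. On the negative half-line, apply the result for
    the positive one to the function - g (- x), which solves the same kind of
    equation. *)
Lemma stein_bound (g k : R -> R) (K : R) :
  (forall x : R, is_derive x 1 g (x * g x + k x)) -> (forall x, `|k x| <= K) ->
  phi x * g x @[x --> +oo] --> 0 -> phi x * g (- x) @[x --> +oo] --> 0 ->
  forall x, `|x * g x| <= K.
Proof.
move=> gE kK gy gNy x.
have K0 : 0 <= K by exact: le_trans (kK 0).
have [x0|x0|->] := ltgtP x 0; last by rewrite mul0r normr0.
  rewrite -(opprK x) mulNr -mulrN.
  apply: (@stein_tail (fun y => - g (- y)) (fun y => k (- y))) => //.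
  - move=> y; have := gE (- y) => ?; apply: is_derive_eq.
    rewrite /GRing.scale/=; ring.
  - have -> : (fun x => phi x * - g (- x)) = - (fun x => phi x * g (- x)).
      by apply/funext => y; rewrite !fctE mulrN.
    by have := cvgN gNy; rewrite oppr0; exact.
  - by rewrite oppr_gt0.
exact: stein_tail gE kK gy _ x0.
Qed.

End stein_equation.

(** * Integration against the normal law *)

Section bounded_functions.
Context d (T : measurableType d) (R : realType).

Lemma bounded_integrable (P : probability T R) (f : T -> R) (M : R) :
  measurable_fun setT f -> (forall x, `|f x| <= M) ->
  P.-integrable setT (EFin \o f).
Proof.
move=> mf fM; apply: measurable_bounded_integrable => //.
  by rewrite (le_lt_trans (probability_le1 _ _)) ?ltry.
exists M; split; first by rewrite num_real.
by move=> y My z _; exact: le_trans (fM z) (ltW My).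
Qed.

Lemma bounded_integrableM (mu : {measure set T -> \bar R}) (f g : T -> R) (M : R) :
  measurable_fun setT f -> (forall x, `|f x| <= M) ->
  mu.-integrable setT (EFin \o g) ->
  mu.-integrable setT (EFin \o (fun x => f x * g x)).
Proof.
move=> mf fM ig; have mg : measurable_fun setT g.
  by apply/measurable_EFinP; exact: measurable_int ig.
have := @integrableZl _ _ _ mu _ measurableT M _ ig.
apply: le_integrable => //.
  by apply/measurable_EFinP; exact: measurable_funM.
move=> x _ /=; rewrite lee_fin !normrM ler_wpM2r//.
by rewrite (le_trans (fM x)) ?ler_norm.
Qed.

Lemma le_Rintegral_bound (P : probability T R) (f : T -> R) (M : R) :
  measurable_fun setT f -> (forall x, `|f x| <= M) ->
  `|\int[P]_x f x| <= M.
Proof.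
move=> mf fM; have intf := bounded_integrable P mf fM.
apply: le_trans (le_normr_Rintegral _ intf) _ => //.
have -> : M = \int[P]_x (cst M x).
  rewrite Rintegral_cst// [X in fine X](_ : _ = 1%E) ?mulr1//.
  exact: probability_setT.
apply: le_Rintegral => //; first exact: integrable_norm.
by apply: (@bounded_integrable _ _ `|M|) => //.
Qed.

End bounded_functions.

Section normal_integral.
Context {R : realType}.
Local Notation phi := (@normal_pdf R 0 1).
Local Notation mu := (@lebesgue_measure R).
Local Notation nu := (@normal_prob R 0 1).

(** The density of the normal law is its Radon-Nikodym derivative, which is
    unique almost everywhere. *)
Lemma integral_normal_prob (f : R -> \bar R) :
  nu.-integrable setT f ->
  (\int[nu]_x f x = \int[mu]_x (f x * (phi x)%:E))%E.
Proof.
move=> intf; have mf := measurable_int _ intf.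
have dom := @normal_prob_dominates R 0 1.
rewrite -(Radon_Nikodym_change_of_variables dom)//=.
apply: ae_eq_integral => //.
- exact: emeasurable_funM.
- apply: emeasurable_funM => //=; apply/measurableT_comp => //=.
  exact: measurable_normal_pdf.
- apply: ae_eqe_mul2l => /=.
  rewrite Radon_NikodymE//=.
  case: cid => /= h [h1 h2 h3].
  apply: integral_ae_eq => //=.
  + by apply: measurableT_comp => //; exact: measurable_normal_pdf.
  + by move=> E _ mE; rewrite -h3.
Qed.

Lemma integrable_phiM (k : R -> R) (M : R) :
  measurable_fun setT k -> (forall x, `|k x| <= M) ->
  mu.-integrable setT (EFin \o (fun x => k x * phi x)).
Proof.
move=> mk kM; apply: (@bounded_integrableM _ (measurableTypeR R) R mu k phi M mk kM).
exact: integrable_normal_pdf.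
Qed.

Lemma Rintegral_normal_prob (k : R -> R) (M : R) :
  measurable_fun setT k -> (forall x, `|k x| <= M) ->
  \int[nu]_x k x = \int[mu]_x (k x * phi x).
Proof.
move=> mk kM; rewrite /Rintegral integral_normal_prob//.
exact: (@bounded_integrable _ (measurableTypeR R) R nu k M mk kM).
Qed.

Lemma PhiE x : Phi x = \int[mu]_(t in `]-oo, x]) phi t. Proof. by []. Qed.

Lemma Phi_ge0 x : 0 <= Phi x :> R. Proof. exact: fine_ge0. Qed.

Lemma Phi_le1 x : Phi x <= 1 :> R.
Proof. by rewrite -lee_fin fineK ?fin_num_measure// probability_le1. Qed.

Let measurable_id_rv : @measurable_fun _ _ (measurableTypeR R) R setT idfun.
Proof. exact: measurable_id. Qed.

Let id_rv : {mfun measurableTypeR R >-> R} :=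
  HB.pack (idfun : measurableTypeR R -> R)
    (isMeasurableFun.Build _ _ _ _ _ measurable_id_rv).

Let Phi_cdf : Phi = fine \o cdf (P := nu) id_rv.
Proof. by []. Qed.

Lemma Phi_cvgy : Phi x @[x --> +oo] --> (1 : R).
Proof.
rewrite Phi_cdf; apply: fine_cvg. exact: cvg_cdfy1.
Qed.

Lemma Phi_cvgNy : Phi (- x) @[x --> +oo] --> (0 : R).
Proof.
rewrite Phi_cdf; apply: fine_cvg.
have := cvg_cdfNy0 (P := nu) id_rv; rewrite cvgNy_compNP; exact.
Qed.

Lemma is_derive_integralNy (k : R -> R) :
  continuous k -> mu.-integrable setT (EFin \o k) ->
  forall x : R, is_derive x 1 (fun y => \int[mu]_(t in `]-oo, y]) k t) (k x).
Proof.
move=> ck ik x.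
have [] := @continuous_FTC1 R k -oo%O x (x + 1) _ _ _ (ck x) => //.
- by rewrite ltrDl.
- exact: integrableS ik.
- by rewrite ltNyr.
move=> dF FE; apply: DeriveDef => //.
by rewrite -derive1E.
Qed.

Lemma integralNy_itvyE (k : R -> R) (x : R) :
  mu.-integrable setT (EFin \o k) ->
  \int[mu]_(t in `[x, +oo[) k t =
  \int[mu]_t k t - \int[mu]_(t in `]-oo, x]) k t.
Proof.
move=> ik; rewrite -Rintegral_itv_obnd_cbnd; last exact: integrableS ik.
by rewrite -(@Rintegral_itvB _ k -oo%O)//= set_itvNyy.
Qed.

Lemma is_derive_Phi (x : R) : is_derive x 1 Phi (phi x).
Proof.
apply: is_derive_integralNy; first by apply: continuous_normal_pdf; exact: oner_neq0.
exact: integrable_normal_pdf.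
Qed.

End normal_integral.

(** * Solution of Stein's equation *)

Section calculus.
Context {R : realType}.

Lemma is_derive_continuous (f df : R -> R) :
  (forall x : R, is_derive x 1 f (df x)) -> continuous f.
Proof.
move=> fE x; apply/differentiable_continuous/derivable1_diffP.
by have [] := fE x.
Qed.

Lemma is_derive_measurable (f df : R -> R) :
  (forall x : R, is_derive x 1 f (df x)) -> measurable_fun setT f.
Proof.
by move=> fE; apply: continuous_measurable_fun; exact: is_derive_continuous fE.
Qed.

Lemma is_derive_lipschitz (f df : R -> R) (K : R) :
  (forall x : R, is_derive x 1 f (df x)) -> (forall x, `|df x| <= K) ->
  forall x y, `|f x - f y| <= K * `|x - y|.
Proof.
move=> fE dfK; suff H x y : x <= y -> `|f y - f x| <= K * `|y - x|.
  move=> x y; have [xy|/ltW yx] := leP x y; last exact: H.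
  by rewrite distrC (distrC x); exact: H.
move=> xy; have [|c _ ->] := @MVT_segment R f df x y xy.
  by apply: continuous_subspaceT; exact: is_derive_continuous fE.
by rewrite normrM ler_wpM2r.
Qed.

End calculus.

Section stein_solution.
Context {R : realType}.
Local Notation phi := (@normal_pdf R 0 1).
Local Notation mu := (@lebesgue_measure R).
Local Notation nu := (@normal_prob R 0 1).

Let phi1_le (x : R) : `|x| <= 1 -> phi 1 <= phi x.
Proof.
move=> x1; rewrite !phiE ler_wpM2l ?normal_peak_ge0// ler_expR lerN2.
by rewrite ler_wpM2r ?invr_ge0// -(real_normK (num_real x)) lerXn2r ?nnegrE ?expr1n.
Qed.

Let integral_le_phi (k : R -> R) (B : R) (D : set (measurableTypeR R)) :
  measurable D -> measurable_fun setT k -> (forall x, `|k x| <= B) ->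
  `|\int[mu]_(t in D) (k t * phi t)| <= B * \int[mu]_(t in D) phi t.
Proof.
move=> mD mk kB; have ik := integrable_phiM mk kB.
have ikD : mu.-integrable D (EFin \o (fun x => k x * phi x)).
  exact: integrableS ik.
have iphi : mu.-integrable D (EFin \o phi).
  by apply: (integrableS measurableT) => //; exact: integrable_normal_pdf.
apply: le_trans (le_normr_Rintegral mD ikD) _.
rewrite -RintegralZl//; apply: le_Rintegral => //.
- exact: integrable_norm.
- by have := @integrableZl _ _ _ mu _ mD B _ iphi.
- move=> x _; rewrite normrM (ger0_norm (normal_pdf_ge0 _ _ _)).
  by rewrite ler_wpM2r ?normal_pdf_ge0.
Qed.

(** Stein's equation f' - x f = h - E h(N). It is solved by f = I / phi, where
    I x is the integral of (h - E h(N)) phi over the half-line t <= x. As I x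
    also is minus the integral over t >= x, it vanishes at both ends, and
    stein_bound gives |x f| <= 2 M, whence bounds on f and f'. Differentiating
    the equation shows that f' solves the equation of stein_bound with
    k = f + h', so f' is Lipschitz. The constant depends on h through M and L
    alone, which is what makes the final estimates uniform over the laws. *)
Lemma stein_solution (M L : R) : exists K : R, forall h dh : R -> R,
  (forall x : R, is_derive x 1 h (dh x)) ->
  (forall x, `|h x| <= M) -> (forall x, `|dh x| <= L) ->
  exists f df : R -> R,
  [/\ forall x : R, is_derive x 1 f (df x),
      forall x, df x - x * f x = h x - \int[nu]_t h t,
      forall x, `|f x| <= K,
      forall x, `|df x| <= K &
      forall x y, `|df x - df y| <= K * `|x - y|].
Proof.
(* C bounds f: for |x| <= 1 because phi x >= phi 1, and for |x| >= 1 because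
   |f x| <= |x f x|. *)
pose C := 2 * M / phi 1 + 2 * M.
exists (`|C| + 4 * `|M| + 2 * (C + L)) => h dh hE hM dhL.
have M0 : 0 <= M by exact: le_trans (hM 0).
have L0 : 0 <= L by exact: le_trans (dhL 0).
have mh := is_derive_measurable hE.
have ch := is_derive_continuous hE.
set c := \int[nu]_t h t.
have cM : `|c| <= M.
  exact: (@le_Rintegral_bound _ (measurableTypeR R) R nu h M mh hM).
pose k x := h x - c.
have kM x : `|k x| <= 2 * M.
  by rewrite (le_trans (ler_normB _ _))// mulr_natl mulr2n lerD.
have mk : measurable_fun setT k by exact: measurable_funB.
have ck : continuous k by move=> x; apply: cvgB; [exact: ch|exact: cvg_cst].
have ik := integrable_phiM mk kM.
have cphi : continuous phi by apply: continuous_normal_pdf; exact: oner_neq0.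
have ckphi : continuous (fun x => k x * phi x).
  by move=> x; apply: cvgM; [exact: ck|exact: cphi].
pose I x := \int[mu]_(t in `]-oo, x]) (k t * phi t).
have IE (x : R) : is_derive x 1 I (k x * phi x) by exact: is_derive_integralNy.
have I_le x : `|I x| <= 2 * M * Phi x by exact: integral_le_phi.
have k0 : \int[mu]_t (k t * phi t) = 0.
  rewrite -(Rintegral_normal_prob mk kM) RintegralB//.
  - rewrite Rintegral_cst// [X in fine X](_ : _ = 1%E) ?mulr1 ?subrr//.
    exact: probability_setT.
  - exact: (@bounded_integrable _ (measurableTypeR R) R nu h M).
  - exact: (@bounded_integrable _ (measurableTypeR R) R nu (cst c) `|c|).
have I_leC x : `|I x| <= 2 * M * (1 - Phi x).
  have -> : I x = - \int[mu]_(t in `[x, +oo[) (k t * phi t).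
    by rewrite (integralNy_itvyE _ ik) k0 sub0r opprK.
  have -> : 1 - Phi x = \int[mu]_(t in `[x, +oo[) phi t.
    rewrite integralNy_itvyE ?PhiE; last exact: integrable_normal_pdf.
    by rewrite [X in _ = X - _]/Rintegral integral_normal_pdf.
  by rewrite normrN; exact: integral_le_phi.
have Iy : I x @[x --> +oo] --> 0.
  apply/norm_cvg0P.
  apply: (@squeeze_cvgr _ _ _ _ (cst 0) (fun x => 2 * M * (1 - Phi x))).
  - by near=> x; rewrite normr_ge0 I_leC.
  - exact: cvg_cst.
  - rewrite -[X in _ --> X](mulr0 (2 * M)) -(subrr 1).
    by apply: cvgMr; apply: cvgB; [exact: cvg_cst|exact: Phi_cvgy].
have INy : I (- x) @[x --> +oo] --> 0.
  apply/norm_cvg0P.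
  apply: (@squeeze_cvgr _ _ _ _ (cst 0) (fun x => 2 * M * Phi (- x))).
  - by near=> x; rewrite normr_ge0 I_le.
  - exact: cvg_cst.
  - by rewrite -[X in _ --> X](mulr0 (2 * M)); apply: cvgMr; exact: Phi_cvgNy.
pose f x := I x / phi x.
have phif x : phi x * f x = I x by rewrite mulrC divfK// phi_neq0.
have fE (x : R) : is_derive x 1 f (x * f x + k x).
  have ? := IE x.
  have phiV := @is_deriveV _ phi x _ _ (phi_neq0 x) (is_derive_phi x).
  have -> : f = I * (fun y => (phi y)^-1) by [].
  apply: is_derive_eq; rewrite /GRing.scale /= !fctE; field; exact: phi_neq0.
have xf x : `|x * f x| <= 2 * M.
  apply: (stein_bound fE kM); first by under eq_fun do rewrite phif.
  by under eq_fun do rewrite -phi_even phif.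
have fC x : `|f x| <= C.
  have [x1|/ltW x1] := leP `|x| 1.
    rewrite /C ler_wpDr ?mulr_ge0// /f normrM normfV (gtr0_norm (phi_gt0 x)).
    rewrite ler_pM ?invr_ge0 ?normal_pdf_ge0//.
    - by apply: le_trans (I_le x) _; rewrite ler_piMr ?mulr_ge0// Phi_le1.
    - by rewrite lef_pV2 ?posrE ?phi_gt0 ?phi1_le.
  rewrite /C ler_wpDl ?divr_ge0 ?mulr_ge0 ?normal_pdf_ge0//.
  by apply: le_trans (xf x); rewrite [leRHS]normrM ler_peMl.
pose df x := x * f x + k x.
have dfM x : `|df x| <= 4 * M.
  rewrite /df (le_trans (ler_normD _ _))//.
  by rewrite (le_trans (lerD (xf x) (kM x)))//; lra.
have dfE (x : R) : is_derive x 1 df (x * df x + (f x + dh x)).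
  have ? := fE x; have ? := hE x.
  have -> : df = id * f + (h - cst c) by [].
  apply: is_derive_eq; rewrite /GRing.scale /= /df !fctE /k; ring.
have fdhC x : `|f x + dh x| <= C + L.
  by rewrite (le_trans (ler_normD _ _))// lerD.
have phidf (g : R -> R) : (forall x, `|g x| <= 4 * M) ->
    phi x * g x @[x --> +oo] --> 0.
  move=> gM; apply/norm_cvg0P.
  apply: (@squeeze_cvgr _ _ _ _ (cst 0) (fun x => phi x * (4 * M))).
  - near=> x; rewrite normr_ge0 normrM (gtr0_norm (phi_gt0 x)).
    by rewrite ler_wpM2l ?normal_pdf_ge0 ?gM.
  - exact: cvg_cst.
  - by rewrite -[X in _ --> X](mul0r (4 * M)); apply: cvgMl; exact: phi_cvgy.
have xdf x : `|x * df x| <= C + L.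
  by apply: (stein_bound dfE fdhC); apply: phidf => y; exact: dfM.
have C0 : 0 <= C by exact: le_trans (fC 0).
exists f, df; split => //.
- by move=> x; rewrite /df addrAC subrr add0r.
- move=> x; apply: le_trans (fC x) _; rewrite !ger0_norm//; lra.
- move=> x; apply: le_trans (dfM x) _; rewrite !ger0_norm//; lra.
- apply: (is_derive_lipschitz dfE) => x.
  rewrite (le_trans (ler_normD _ _))// (le_trans (lerD (xdf x) (fdhC x)))//.
  rewrite !ger0_norm//; lra.
Unshelve. all: by end_near. Qed.

End stein_solution.

(** * Independence *)

Section independence.
Context d (Om : measurableType d) (R : realType) (Q : probability Om R).

Definition indep_pair (X Y : Om -> R) := forall A B, measurable A -> measurable B ->
  Q (X @^-1` A `&` Y @^-1` B) = (Q (X @^-1` A) * Q (Y @^-1` B))%E.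

Definition indep_family n (X : 'I_n -> Om -> R) :=
  forall (J : {set 'I_n}) (A : 'I_n -> set R), (forall i, measurable (A i)) ->
  Q (\bigcap_(i in [set i | i \in J]) (X i @^-1` A i)) =
  (\prod_(i in J) Q (X i @^-1` A i))%E.

(** Once A is fixed, E |-> Q (E and X_i in A) and E |-> Q E * Q (X_i in A) are
    finite measures that agree on the pi-system G of the cylinders in the other
    variables, hence on the sigma-algebra generated by G, for which the sum of
    the other variables is measurable. *)
Lemma indep_family_sum n (X : 'I_n -> Om -> R) (i : 'I_n) :
  (forall k, measurable_fun setT (X k)) -> indep_family X ->
  indep_pair (X i) (fun w => \sum_(k < n | k != i) X k w).
Proof.
move=> mX indX A B mA mB.
pose J := [set~ i]%SET.
pose G : set (set Om) := [set E | exists C : 'I_n -> set R,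
  (forall k, measurable (C k)) /\
  E = \bigcap_(k in [set k | k \in J]) (X k @^-1` C k)].
have mXP k C : measurable C -> measurable (X k @^-1` C).
  by move=> mC; rewrite -[X in measurable X]setTI; exact: mX.
have mE := mXP i A mA.
have q0 : 0 <= fine (Q (X i @^-1` A)) by exact: fine_ge0.
pose q : {nonneg R} := NngNum q0.
have GT : G setT.
  exists (fun=> setT); split => //; apply/seteqP; split => //.
have Gm : G `<=` measurable.
  by move=> _ [C [mC ->]]; apply: fin_bigcap_measurable => // k _; exact: mXP.
have GI : setI_closed G.
  move=> _ _ [C [mC ->]] [D [mD ->]]; exists (fun k => C k `&` D k); split.
    by move=> k; exact: measurableI.
  by rewrite -bigcapI.
have GE E : G E -> mrestr Q mE E = mscale q Q E.
  move=> [C [mC ->]]; rewrite /mrestr /mscale/= fineK ?fin_num_measure//.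
  pose D k := if k == i then A else C k.
  have mD k : measurable (D k) by rewrite /D; case: ifP.
  have -> : (\bigcap_(k in [set k | k \in J]) (X k @^-1` C k)) `&` X i @^-1` A =
      \bigcap_(k in [set k | k \in [set: 'I_n]%SET]) (X k @^-1` D k).
    apply/seteqP; split=> [w [Cw Aw] k _|w Dw].
      rewrite /D; case: eqP => [->//|/eqP ki].
      by apply: (Cw k); rewrite /= !inE.
    split; last by have := Dw i; rewrite /D eqxx; apply; rewrite /= inE.
    move=> k; rewrite /= !inE => ki; have := Dw k.
    by rewrite /D (negbTE ki); apply; rewrite /= inE.
  rewrite (indX _ _ mD) (indX _ _ mC) (bigD1 i)/= ?inE//; congr (_ * _)%E.
    by rewrite /D eqxx.
  by apply: eq_big => k; rewrite !inE// => ki; rewrite /D (negbTE ki).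
have Q_fin : forall k : nat, (mrestr Q mE setT < +oo)%E.
  by move=> _; rewrite /mrestr setTI (le_lt_trans (probability_le1 _ _))// ltry.
have cover : \bigcup_(k : nat) [set: Om] = setT.
  by apply: bigcup_const; exists 0%N.
have QE := @g_sigma_algebra_measure_unique _ R _ G Gm (fun=> setT)
  (fun=> GT) cover (mrestr Q mE) (mscale q Q) GI GE Q_fin.
pose h k : Om -> R := if k != i then X k else cst 0.
have mh k : @measurable_fun _ _ (g_sigma_algebraType G) R setT (h k).
  rewrite /h; case: ifP => [ki|_]; last exact: measurable_cst.
  move=> _ C mC; apply: sub_sigma_algebra; rewrite setTI.
  exists (fun l => if l == k then C else setT); split.
    by move=> l; case: ifP.
  apply/seteqP; split=> [w Cw l _|w Cw]; first by case: eqP => [->|].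
  by have := Cw k; rewrite eqxx; apply; rewrite /= !inE.
have mS : @measurable_fun _ _ (g_sigma_algebraType G) R setT
    (fun w => \sum_(k < n | k != i) X k w).
  rewrite (_ : (fun w => _) = (fun w => \sum_k h k w)).
    exact: measurable_sum.
  apply/funext => w; rewrite big_mkcond/=; apply: eq_bigr => k _.
  by rewrite /h; case: ifP.
have := QE _ (mS measurableT _ mB); rewrite setTI /mrestr /mscale/=.
by move=> QSB; rewrite setIC [LHS]QSB /mscale/= fineK ?fin_num_measure.
Qed.

(** The law of (X, Y) is the product of the laws, so this is Fubini's theorem.
    One factor may be unbounded: u will be a power, v a Stein solution. *)
Lemma indep_pair_expectation (X Y : Om -> R) (u v : R -> R) (M : R) :
  measurable_fun setT X -> measurable_fun setT Y -> indep_pair X Y ->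
  measurable_fun setT u -> measurable_fun setT v ->
  Q.-integrable setT (EFin \o (u \o X)) -> (forall y, `|v y| <= M) ->
  \int[Q]_w (u (X w) * v (Y w)) = (\int[Q]_w u (X w)) * (\int[Q]_w v (Y w)).
Proof.
move=> mX mY XY mu mv iu vM.
pose X' : {mfun Om >-> R} := HB.pack X (isMeasurableFun.Build _ _ _ _ _ mX).
pose Y' : {mfun Om >-> R} := HB.pack Y (isMeasurableFun.Build _ _ _ _ _ mY).
have mZ : measurable_fun setT (fun w => (X w, Y w)) by exact: measurable_fun_pair.
pose Z : {mfun Om >-> (R * R)%type} :=
  HB.pack (fun w => (X w, Y w)) (isMeasurableFun.Build _ _ _ _ _ mZ).
pose mX' := distribution Q X'; pose mY' := distribution Q Y'.
pose f (p : R * R) := (u p.1 * v p.2)%:E.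
have mf : measurable_fun setT f.
  apply/measurable_EFinP; apply: measurable_funM.
    exact: measurableT_comp.
  exact: measurableT_comp.
have ifZ : Q.-integrable setT (f \o Z).
  have mvY : measurable_fun setT (v \o Y) by exact: measurableT_comp.
  have := bounded_integrableM mvY (fun w => vM (Y w)) iu.
  by apply: eq_integrable => // w _; rewrite /f/= mulrC.
have ZE (g : R * R -> \bar R) :
    (\int[mX' \x mY']_p g p = \int[distribution Q Z]_p g p)%E.
  apply: eq_measure_integral => A mA _.
  by apply: product_measure_unique => // B C mB mC; exact: XY.
have iprod : (mX' \x mY')%E.-integrable setT f.
  apply/integrableP; split => //; rewrite ZE ge0_integral_distribution//.
    by have /integrableP[] := ifZ.
  exact: measurableT_comp.
have Ef : (\int[Q]_w f (Z w) = \int[mX']_x \int[mY']_y f (x, y))%E.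
  by rewrite (integral12_prod_meas1 iprod) ZE integral_distribution.
rewrite /Rintegral -[X in fine X]/(\int[Q]_w f (Z w))%E Ef.
have iv : mY'.-integrable setT (EFin \o v) by exact: bounded_integrable vM.
have iu' : mX'.-integrable setT (EFin \o u).
  by apply: integrable_pushforward => //; exact/measurable_EFinP.
have mvY : measurable_fun setT (v \o Y) by exact: measurableT_comp.
have ivQ : Q.-integrable setT (EFin \o (v \o Y)).
  exact: bounded_integrable (fun w => vM (Y w)).
have vE : (\int[mY']_y (v y)%:E = \int[Q]_w (v (Y w))%:E)%E.
  rewrite integral_distribution//; exact/measurable_EFinP.
have uE : (\int[mX']_y (u y)%:E = \int[Q]_w (u (X w))%:E)%E.
  rewrite integral_distribution//; exact/measurable_EFinP.
have fv := integrable_fin_num measurableT ivQ.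
have fE x : (\int[mY']_y f (x, y) = (u x)%:E * \int[Q]_w (v (Y w))%:E)%E.
  by rewrite -vE -integralZl//; apply: eq_integral => y _; rewrite /f EFinM.
rewrite (eq_integral (fun x => (u x)%:E * \int[Q]_w (v (Y w))%:E)%E); last first.
  by move=> x _; exact: fE.
rewrite -(fineK fv).
rewrite integralZr//= uE fineM//.
exact: integrable_fin_num iu.
Qed.

End independence.

(** * The central limit theorem with a rate *)

Section stein_sum.
Context d (Om : measurableType d) (R : realType) (Q : probability Om R).

Lemma Rintegral_sum (I : Type) (s : seq I) (g : I -> Om -> R) :
  (forall i, Q.-integrable setT (EFin \o g i)) ->
  \int[Q]_w (\sum_(i <- s) g i w) = \sum_(i <- s) \int[Q]_w g i w.
Proof.
move=> ig; rewrite /Rintegral.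
under eq_integral do rewrite -sumEFin.
rewrite (integral_sum measurableT ig) -sum_fine// => i _.
exact: integrable_fin_num.
Qed.

Lemma taylor_lipschitz (f df : R -> R) (K : R) :
  (forall x : R, is_derive x 1 f (df x)) ->
  (forall x y, `|df x - df y| <= K * `|x - y|) ->
  forall x y, `|f (y + x) - f y - x * df y| <= K * `|x| ^+ 2.
Proof.
move=> fE dfK x y; pose g t := f (y + t) - f y - t * df y.
have gE (t : R) : is_derive t 1 g (df (y + t) - df y).
  have ? := fE (y + t).
  have -> : g = (f \o (fun t => y + t)) - cst (f y) - (fun t => df y *: t).
    by apply/funext => u; rewrite /g /= !fctE /= mulrC.
  by apply: is_derive_eq; rewrite /GRing.scale/=; ring.
have -> : f (y + x) - f y - x * df y = g x - g 0.
  by rewrite /g addr0 mul0r subrr !subr0.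
have [x0|/ltW x0] := leP 0 x.
  have [|c /[!in_itv]/= /andP[c0 cx] ->] :=
      @MVT_segment R g _ 0 x x0 (fun t _ => gE t).
    by apply: continuous_subspaceT; exact: is_derive_continuous gE.
  rewrite subr0 normrM expr2 mulrA ler_wpM2r// (le_trans (dfK _ _))//.
  rewrite addrAC subrr add0r !ger0_norm// ler_wpM2l//.
  by have := le_trans (normr_ge0 _) (dfK 1 0); rewrite subr0 normr1 mulr1.
have [|c /[!in_itv]/= /andP[c0 cx] E] :=
    @MVT_segment R g _ x 0 x0 (fun t _ => gE t).
  by apply: continuous_subspaceT; exact: is_derive_continuous gE.
rewrite distrC E sub0r normrM normrN expr2 mulrA ler_wpM2r//.
rewrite (le_trans (dfK _ _))//.
rewrite addrAC subrr add0r !ler0_norm// ler_wpM2l//.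
  by have := le_trans (normr_ge0 _) (dfK 1 0); rewrite subr0 normr1 mulr1.
by rewrite lerN2.
Qed.

Lemma integrable_cube (X : Om -> R) (u : R -> R) (c : R) :
  measurable_fun setT X -> Q.-integrable setT (EFin \o (fun w => `|X w| ^+ 3)) ->
  measurable_fun setT u -> (forall x, `|u x| <= c * (1 + `|x| ^+ 3)) ->
  Q.-integrable setT (EFin \o (u \o X)).
Proof.
move=> mX iX mu uc.
have i1 : Q.-integrable setT (EFin \o cst 1).
  exact: (@bounded_integrable _ _ _ Q (cst 1) `|1|).
have iD := integrableD measurableT i1 iX.
have := @integrableZl _ _ _ Q _ measurableT c _ iD; apply: le_integrable => //.
  by apply/measurable_EFinP; exact: measurableT_comp.
by move=> w _; rewrite /= lee_fin (le_trans (uc _))// ler_norm.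
Qed.

(** The contribution of one summand X to E [f'(S) - S f(S)], where S = Y + X.
    Expanding f at Y, the main part s^2 f'(Y) - X f(Y) - X^2 f'(Y) has mean
    zero because Y is independent of X, whose first two moments are 0 and s^2.
    What remains is at most s^2 K |X| + K |X|^3. *)
Lemma stein_summand (X Y : Om -> R) (f df : R -> R) (K s a : R) :
  measurable_fun setT X -> measurable_fun setT Y -> indep_pair Q X Y ->
  (forall x : R, is_derive x 1 f (df x)) ->
  (forall x, `|f x| <= K) -> (forall x, `|df x| <= K) -> continuous df ->
  (forall x y, `|df x - df y| <= K * `|x - y|) ->
  0 <= s -> Q.-integrable setT (EFin \o (fun w => `|X w| ^+ 3)) ->
  \int[Q]_w X w = 0 -> \int[Q]_w X w ^+ 2 = s ^+ 2 ->
  \int[Q]_w `|X w| ^+ 3 <= a ->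
  `|\int[Q]_w (s ^+ 2 * df (Y w + X w) - X w * f (Y w + X w))| <=
    K * (2 * a + s ^+ 3).
Proof.
move=> mX mY XY fE fK dfK cdf dfL s0 iX3 EX EX2 EX3.
have K0 : 0 <= K by exact: le_trans (fK 0).
have mf := is_derive_measurable fE.
have mdf : measurable_fun setT df by exact: continuous_measurable_fun.
have le_cube k (x : R) : (k <= 3)%N -> `|x ^+ k| <= 1 * (1 + `|x| ^+ 3).
  move=> k3; rewrite mul1r normrX; have [x1|/ltW x1] := leP `|x| 1.
    by apply: (@le_trans _ _ 1); rewrite ?exprn_ile1// lerDl exprn_ge0.
  by apply: (le_trans (ler_weXn2l x1 k3)); rewrite lerDr.
have iX : Q.-integrable setT (EFin \o X).
  apply: (integrable_cube mX iX3 _ (fun x => le_cube 1%N x isT)).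
  exact: measurable_id.
have iX2 : Q.-integrable setT (EFin \o (fun w => X w ^+ 2)).
  apply: (integrable_cube mX iX3 _ (fun x => le_cube 2%N x isT)).
  exact: measurable_funX.
have mfY : measurable_fun setT (f \o Y) by exact: measurableT_comp.
have mdfY : measurable_fun setT (df \o Y) by exact: measurableT_comp.
have mS : measurable_fun setT (fun w => Y w + X w) by exact: measurable_funD.
have mfS : measurable_fun setT (fun w => f (Y w + X w)).
  exact: measurableT_comp mS.
have mdfS : measurable_fun setT (fun w => df (Y w + X w)).
  exact: measurableT_comp mS.
pose T2 w := s ^+ 2 * df (Y w) - X w * f (Y w) - X w ^+ 2 * df (Y w).
pose D w := s ^+ 2 * df (Y w + X w) - X w * f (Y w + X w).
have intM (g Z : Om -> R) : measurable_fun setT g -> (forall w, `|g w| <= K) ->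
    Q.-integrable setT (EFin \o Z) ->
    Q.-integrable setT (EFin \o (fun w => Z w * g w)).
  move=> mg gK iZ; have := bounded_integrableM mg gK iZ.
  by apply: eq_integrable => // w _ /=; rewrite mulrC.
have ic : Q.-integrable setT (EFin \o cst (s ^+ 2)).
  exact: (@bounded_integrable _ _ _ Q (cst (s ^+ 2)) `|s ^+ 2|).
have i1 := intM _ _ mdfY (fun w => dfK (Y w)) ic.
have i2 := intM _ _ mfY (fun w => fK (Y w)) iX.
have i3 := intM _ _ mdfY (fun w => dfK (Y w)) iX2.
have i12 := integrableB measurableT i1 i2.
have iT2 : Q.-integrable setT (EFin \o T2) := integrableB measurableT i12 i3.
have iD : Q.-integrable setT (EFin \o D) := integrableB measurableT
  (intM _ _ mdfS (fun w => dfK (Y w + X w)) ic)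
  (intM _ _ mfS (fun w => fK (Y w + X w)) iX).
have mid : measurable_fun setT (id : R -> R) by exact: measurable_id.
have ET2 : \int[Q]_w T2 w = 0.
  rewrite (RintegralB _ i12 i3)// (RintegralB _ i1 i2)//.
  have := @indep_pair_expectation _ _ _ Q X Y id f K mX mY XY mid mf iX fK.
  rewrite /= EX mul0r => ->.
  have := @indep_pair_expectation _ _ _ Q X Y (fun x => x ^+ 2) df K mX mY XY
    (measurable_funX 2 mid) mdf iX2 dfK.
  rewrite /= EX2 => ->; rewrite subr0 RintegralZl ?subrr//.
  by apply: bounded_integrable mdfY _ => w; exact: dfK.
have -> : \int[Q]_w (s ^+ 2 * df (Y w + X w) - X w * f (Y w + X w)) =
    \int[Q]_w (D w - T2 w).
  by rewrite (RintegralB _ iD iT2)// ET2 subr0.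
have iDT : Q.-integrable setT (EFin \o (fun w => D w - T2 w)) :=
  integrableB measurableT iD iT2.
apply: le_trans (le_normr_Rintegral _ iDT) _ => //.
(* Compare |x| with s: this trades the first moment of X for its third one. *)
have cs (x : R) : s ^+ 2 * `|x| <= `|x| ^+ 3 + s ^+ 3.
  have [xs|/ltW sx] := leP `|x| s.
    rewrite ler_wpDl ?exprn_ge0// (exprS s 2) mulrC ler_wpM2r ?exprn_ge0//.
  by rewrite ler_wpDr ?exprn_ge0// (exprSr _ 2) ler_wpM2r// lerXn2r//.
have bound w : `|D w - T2 w| <= K * (2 * `|X w| ^+ 3 + s ^+ 3).
  have -> : D w - T2 w = s ^+ 2 * (df (Y w + X w) - df (Y w)) -
      X w * (f (Y w + X w) - f (Y w) - X w * df (Y w)) by rewrite /D /T2; ring.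
  apply: le_trans (ler_normB _ _) _.
  rewrite [X in X + _]normrM [X in _ + X]normrM (ger0_norm (sqr_ge0 s)).
  have := ler_wpM2l (sqr_ge0 s) (dfL (Y w + X w) (Y w)).
  rewrite addrAC subrr add0r => h1.
  have := ler_wpM2l (normr_ge0 (X w)) (taylor_lipschitz fE dfL (X w) (Y w)) => h2.
  have := ler_wpM2l K0 (cs (X w)) => h3.
  apply: le_trans (lerD h1 h2) _.
  have -> : `|X w| * (K * `|X w| ^+ 2) = K * `|X w| ^+ 3 by ring.
  by move: h3; rewrite mulrCA; lra.
have iB : Q.-integrable setT (EFin \o (fun w => 2 * `|X w| ^+ 3)).
  exact: (@integrableZl _ _ _ Q _ measurableT 2 _ iX3).
have ic3 : Q.-integrable setT (EFin \o cst (s ^+ 3)).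
  exact: (@bounded_integrable _ _ _ Q (cst (s ^+ 3)) `|s ^+ 3|).
have iBc : Q.-integrable setT (EFin \o (fun w => 2 * `|X w| ^+ 3 + s ^+ 3)) :=
  integrableD measurableT iB ic3.
apply: (@le_trans _ _ (\int[Q]_w (K * (2 * `|X w| ^+ 3 + s ^+ 3)))).
  apply: le_Rintegral => //; first exact: integrable_norm.
  exact: (@integrableZl _ _ _ Q _ measurableT K _ iBc).
rewrite (RintegralZl K measurableT iBc)// ler_wpM2l// (RintegralD _ iB ic3)//.
rewrite (RintegralZl 2 measurableT iX3)// Rintegral_cst//.
rewrite [X in fine X](_ : _ = 1%E) ?mulr1; last exact: probability_setT.
by rewrite lerD2r ler_wpM2l.
Qed.

End stein_sum.

(** Stein's equation at S reads h(S) - E h(N) = sum_i (s^2 f'(S) - X_i f(S)),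
    as n s^2 = 1. Each of the n terms has mean O(s^3), so the total is O(s). *)
Lemma clt_rate (R : realType) (M L : R) : exists2 C : R, 0 <= C &
  forall d (Om : measurableType d) (Q : probability Om R) n (X : 'I_n -> Om -> R)
    (h dh : R -> R) (s m3 : R),
  (0 < n)%N -> s = (Num.sqrt n%:R)^-1 ->
  (forall i, measurable_fun setT (X i)) -> indep_family Q X ->
  (forall i, Q.-integrable setT (EFin \o (fun w => `|X i w| ^+ 3))) ->
  (forall i, \int[Q]_w X i w = 0) -> (forall i, \int[Q]_w X i w ^+ 2 = s ^+ 2) ->
  (forall i, \int[Q]_w `|X i w| ^+ 3 <= s ^+ 3 * m3) ->
  (forall x : R, is_derive x 1 h (dh x)) ->
  (forall x, `|h x| <= M) -> (forall x, `|dh x| <= L) ->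
  `|\int[Q]_w h (\sum_i X i w) - \int[normal_prob 0 1]_t h t| <=
    C * (2 * m3 + 1) * s.
Proof.
have [K KP] := stein_solution M L; exists `|K| => //.
move=> d Om Q n X h dh s m3 n0 sE mX indX iX3 EX EX2 EX3 hE hM dhL.
have [f [df [fE steinE fK dfK dfL]]] := KP h dh hE hM dhL.
have K0 : 0 <= K by exact: le_trans (fK 0).
have s0 : 0 <= s by rewrite sE invr_ge0.
have ns2 : n%:R * s ^+ 2 = 1.
  by rewrite sE exprVn sqr_sqrtr// divff// pnatr_eq0 -lt0n.
have cf := is_derive_continuous fE.
have ch := is_derive_continuous hE.
have cdf : continuous df.
  rewrite (_ : df = (fun x => h x - \int[normal_prob 0 1]_t h t + x * f x)).
    move=> x; apply: cvgD; first by apply: cvgB; [exact: ch|exact: cvg_cst].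
    by apply: cvgM; [exact: cvg_id|exact: cf].
  by apply/funext => x; rewrite -steinE subrK.
have mf := is_derive_measurable fE.
have mh := is_derive_measurable hE.
have mdf : measurable_fun setT df by exact: continuous_measurable_fun.
pose S w := \sum_i X i w.
have mS : measurable_fun setT S by exact: measurable_sum.
pose g i w := s ^+ 2 * df (S w) - X i w * f (S w).
have ig i : Q.-integrable setT (EFin \o g i).
  have iX : Q.-integrable setT (EFin \o X i).
    apply: (integrable_cube (u := id) (c := 1) (mX i) (iX3 i)).
      exact: measurable_id.
    move=> x; rewrite mul1r; have [x1|/ltW x1] := leP `|x| 1.
      by rewrite ler_wpDr.
    by rewrite ler_wpDl// -[leLHS]expr1 ler_weXn2l.
  have i1 : Q.-integrable setT (EFin \o (fun w => s ^+ 2 * df (S w))).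
    have idfS : Q.-integrable setT (EFin \o (df \o S)).
      exact: bounded_integrable (measurableT_comp mdf mS) (fun w => dfK (S w)).
    exact: (@integrableZl _ _ _ Q _ measurableT (s ^+ 2) _ idfS).
  have i2 : Q.-integrable setT (EFin \o (fun w => X i w * f (S w))).
    have mfS : measurable_fun setT (f \o S) by exact: measurableT_comp.
    have := bounded_integrableM mfS (fun w => fK (S w)) iX.
    by apply: eq_integrable => // w _ /=; rewrite mulrC.
  exact: (integrableB measurableT i1 i2).
have -> : \int[Q]_w h (S w) - \int[normal_prob 0 1]_t h t =
    \sum_i \int[Q]_w g i w.
  rewrite -Rintegral_sum//.
  have E w : \sum_i g i w = h (S w) - cst (\int[normal_prob 0 1]_t h t) w.
    rewrite /= -steinE /g sumrB sumr_const card_ord -mulr_suml -[_ *+ n]mulr_natl.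
    by rewrite mulrA ns2 mul1r.
  under [RHS]eq_Rintegral do rewrite E.
  rewrite RintegralB//.
  - rewrite Rintegral_cst// [X in fine X](_ : _ = 1%E) ?mulr1//.
    exact: probability_setT.
  - exact: bounded_integrable (measurableT_comp mh mS) (fun w => hM (S w)).
  - exact: (@bounded_integrable _ _ _ Q (cst _) `|\int[normal_prob 0 1]_t h t|).
apply: le_trans (ler_norm_sum _ _ _) _.
have gi i : `|\int[Q]_w g i w| <= K * (2 * (s ^+ 3 * m3) + s ^+ 3).
  pose Y w := \sum_(k < n | k != i) X k w.
  have mY : measurable_fun setT Y.
    rewrite (_ : Y = S \- X i); first exact: measurable_funB.
    by apply/funext => w; rewrite /Y /S /= [in RHS](bigD1 i)//= addrAC subrr add0r.
  have SE w : S w = Y w + X i w by rewrite /S /Y (bigD1 i)//= addrC.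
  have := @stein_summand _ _ _ Q (X i) Y f df K s _ (mX i) mY
    (indep_family_sum i mX indX) fE fK dfK cdf dfL s0 (iX3 i) (EX i) (EX2 i) (EX3 i).
  by under eq_Rintegral do rewrite -SE.
apply: (le_trans (ler_sum _ (fun i _ => gi i))).
rewrite sumr_const card_ord -[_ *+ n]mulr_natl ger0_norm//.
have -> : n%:R * (K * (2 * (s ^+ 3 * m3) + s ^+ 3)) =
    (n%:R * s ^+ 2) * (K * (2 * m3 + 1) * s) by ring.
by rewrite ns2 mul1r.
Qed.

(** * Marginals of power measures *)

Section marginals.
Context d (T : measurableType d) (R : realType) (mu : probability T R).

Lemma power_measure_setT n : power_measure mu n setT = 1%E.
Proof.
elim: n => [|n IH]; first by rewrite /= diracT.
rewrite /= /power_step /pushforward preimage_setT -setXTT product_measure1E//.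
by rewrite [X in (X * _)%E](probability_setT mu) mul1e.
Qed.

Lemma power_measure_marginal n (j : 'I_n) (A : set T) : measurable A ->
  power_measure mu n ((fun t : n.-tuple T => tnth t j) @^-1` A) = mu A.
Proof.
move=> mA; elim: n j => [[]//|n IH] j.
rewrite /= /power_step /pushforward; case: (unliftP ord0 j) => [k ->|->].
  rewrite (_ : _ @^-1` _ = setT `*` ((fun t : n.-tuple T => tnth t k) @^-1` A)).
    rewrite product_measure1E//.
      by rewrite [X in (X * _)%E](probability_setT mu) mul1e.
    by rewrite -[X in measurable X]setTI; exact: measurable_tnth.
  by apply/seteqP; split=> [[x t]|[x t] []]; rewrite /= tnthS//.
rewrite (_ : _ @^-1` _ = A `*` setT).
  by rewrite product_measure1E// [X in (_ * X)%E]power_measure_setT mule1.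
by apply/seteqP; split=> [[x t]|[x t] []]; rewrite /= tnth0.
Qed.

Lemma integral_marginal n (j : 'I_n) (g : T -> R) (M : R) :
  measurable_fun setT g -> (forall x, `|g x| <= M) ->
  \int[power_measure mu n]_t g (tnth t j) = \int[mu]_x g x.
Proof.
move=> mg gM; pose p (t : n.-tuple T) := tnth t j.
have mp : measurable_fun setT p by exact: measurable_tnth.
pose p' : {mfun n.-tuple T >-> T} :=
  HB.pack p (isMeasurableFun.Build _ _ _ _ _ mp).
have mgp : measurable_fun setT (g \o p) by exact: measurableT_comp.
have igp : (power_measure mu n).-integrable setT (EFin \o (g \o p)).
  apply: measurable_bounded_integrable => //.
    by rewrite [ltLHS](_ : _ = 1%E) ?ltry//; exact: power_measure_setT.
  exists M; split; first by rewrite num_real.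
  by move=> y My t _; exact: le_trans (gM _) (ltW My).
rewrite /Rintegral; congr fine.
transitivity (\int[pushforward (power_measure mu n) p']_y (g y)%:E)%E.
  by rewrite (integral_pushforward mp) ?preimage_setT//; exact/measurable_EFinP.
by apply: eq_measure_integral => A mA _; exact: power_measure_marginal.
Qed.

End marginals.

(** * Regularity of the selection weight and of the pivot *)

Lemma Rintegral_gt0 d (T : measurableType d) (R : realType) (P : probability T R)
    (f : T -> R) (M : R) :
  measurable_fun setT f -> (forall x, `|f x| <= M) -> (forall x, 0 < f x) ->
  0 < \int[P]_x f x.
Proof.
move=> mf fM f0; rewrite lt_neqAle Rintegral_ge0 ?andbT; last first.
  by move=> x _; exact: ltW.
apply/eqP => /esym int0.
have fin : (\int[P]_x (f x)%:E)%E \is a fin_num.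
  by apply: integrable_fin_num => //; exact: bounded_integrable fM.
have : (\int[P]_x `|(f x)%:E| = 0)%E.
  under eq_integral do rewrite abse_EFin ger0_norm ?ltW//.
  by rewrite -(fineK fin) -/(Rintegral P setT f) int0.
move/ae_eq_integral_abs => /(_ measurableT)[|N [mN N0 sub]].
  exact/measurable_EFinP.
have : P setT = 0%E.
  apply: (subset_measure0 _ mN _ N0) => // x _.
  apply: sub => /= /(_ I) /eqP; rewrite eqe => /eqP fx0.
  by have := f0 x; rewrite fx0 ltxx.
by rewrite (probability_setT P) => /eqP; rewrite onee_eq0.
Qed.

Section selection_weight.
Context {R : realType}.
Local Notation phi := (@normal_pdf R 0 1).
Local Notation mu := (@lebesgue_measure R).
Local Notation nu := (@normal_prob R 0 1).
Implicit Types (rho z b : R) (H : R -> R).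

Lemma Phi_lt (x y : R) : x < y -> Phi x < Phi y.
Proof.
move=> xy; rewrite -subr_gt0.
have [|c _ ->] := @MVT R Phi phi x y xy (fun z _ => is_derive_Phi z).
  by apply: continuous_subspaceT; exact: is_derive_continuous is_derive_Phi.
by rewrite mulr_gt0 ?phi_gt0// subr_gt0.
Qed.

Lemma Phibar_gt0 (x : R) : 0 < Phibar x.
Proof.
by rewrite subr_gt0 (lt_le_trans (@Phi_lt x (x + 1) _)) ?ltrDl// Phi_le1.
Qed.

Lemma G1_gt0 rho z b : 0 < G1 rho z b. Proof. exact: Phibar_gt0. Qed.

Lemma normr_G1_le1 rho z b : `|G1 rho z b| <= 1.
Proof. by rewrite gtr0_norm ?G1_gt0// lerBlDr lerDl Phi_ge0. Qed.

Lemma G1_nondecreasing rho z b b' : 0 < rho -> b <= b' ->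
  G1 rho z b <= G1 rho z b'.
Proof.
move=> rho0 bb'; rewrite lerD2l lerN2.
have : - (z + b') / rho <= - (z + b) / rho.
  by rewrite ler_pM2r ?invr_gt0// lerN2 lerD2l.
by rewrite le_eqVlt => /predU1P[->//|/Phi_lt/ltW].
Qed.

Lemma is_derive_G1 rho (z : R) b :
  is_derive z 1 (fun z => G1 rho z b) (phi (- (z + b) / rho) / rho).
Proof.
pose a (z : R) := (- rho^-1) *: (z + b).
have aE y : a y = - (y + b) / rho by rewrite /a /GRing.scale/= mulrC mulrN mulNr.
have -> : (fun z => G1 rho z b) = cst 1 - (Phi \o a).
  by apply/funext => y; rewrite !fctE /= aE.
have ? : is_derive z 1 a (- rho^-1).
  by apply: is_derive_eq; rewrite /GRing.scale/= addr0 mulr1.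
have ? := is_derive_Phi (a z).
apply: is_derive_eq; rewrite aE sub0r; ring.
Qed.

Lemma normr_dG1_le rho z b : 0 < rho ->
  `|phi (- (z + b) / rho) / rho| <= normal_peak 1 / rho.
Proof.
move=> rho0; rewrite ger0_norm; last by rewrite divr_ge0 ?normal_pdf_ge0// ltW.
by rewrite ler_pM2r ?invr_gt0// phi_le_peak.
Qed.

Lemma measurable_G1 rho b : measurable_fun setT (fun z => G1 rho z b).
Proof. exact: is_derive_measurable (fun z => is_derive_G1 rho z b). Qed.

Definition sel_mass rho b : R := \int[nu]_z G1 rho z b.

Lemma sel_mass_gt0 rho b : 0 < sel_mass rho b.
Proof.
apply: (@Rintegral_gt0 _ (measurableTypeR R) R nu _ 1 (measurable_G1 rho b)).
- by move=> z; exact: normr_G1_le1.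
- by move=> z; exact: G1_gt0.
Qed.

Lemma sel_mass_nondecreasing rho b b' : 0 < rho -> b <= b' ->
  sel_mass rho b <= sel_mass rho b'.
Proof.
move=> rho0 bb'; apply: le_Rintegral => //.
- exact: (@bounded_integrable _ (measurableTypeR R) R nu _ 1 (measurable_G1 rho b)
    (fun z => normr_G1_le1 rho z b)).
- exact: (@bounded_integrable _ (measurableTypeR R) R nu _ 1 (measurable_G1 rho b')
    (fun z => normr_G1_le1 rho z b')).
- by move=> z _; exact: G1_nondecreasing.
Qed.

Lemma D_sel_mass d (j : 'I_d) rho b : D_ j rho b = sel_mass rho b.
Proof.
exact: (integral_marginal nu j (measurable_G1 rho b)
  (fun z => normr_G1_le1 rho z b)).
Qed.

(** The denominator of the pivot is the probability of selection, and its
    numerator is that probability minus an integral over t <= z. *)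
Lemma is_derive_pivot rho (z : R) b :
  is_derive z 1 (fun z => pivot rho z b) (- (phi z * G1 rho z b) / sel_mass rho b).
Proof.
pose k z := G1 rho z b * phi z.
have kE : (fun v => phi v * Phibar (- (v + b) / rho)) = k.
  by apply/funext => v; rewrite /k mulrC.
have ik := integrable_phiM (measurable_G1 rho b) (fun z => normr_G1_le1 rho z b).
have ck : continuous k.
  move=> y; apply: cvgM; last by apply: continuous_normal_pdf; exact: oner_neq0.
  exact: (is_derive_continuous (fun z => is_derive_G1 rho z b)).
have massE : \int[mu]_v k v = sel_mass rho b.
  by rewrite -(Rintegral_normal_prob (measurable_G1 rho b)
    (fun z => normr_G1_le1 rho z b)).
have ? := is_derive_integralNy ck ik z.
have -> : (fun z => pivot rho z b) =
    (sel_mass rho b)^-1 *: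
    (cst (sel_mass rho b) - (fun y => \int[mu]_(t in `]-oo, y]) k t)).
  apply/funext => y; rewrite /pivot kE (integralNy_itvyE y ik) massE.
  by rewrite !fctE /GRing.scale/= mulrC.
apply: is_derive_eq; rewrite /GRing.scale/= /k; ring.
Qed.

Section weighted_test_function.
Variables (rho : R) (H dH : R -> R) (M delta : R).
Hypotheses (rho0 : 0 < rho) (HE : forall x : R, is_derive x 1 H (dH x)).
Hypotheses (HM : forall x, `|H x| <= M) (dHM : forall x, `|dH x| <= M).

Lemma normr_G2_le z b : `|G2 rho H z b| <= M.
Proof.
rewrite /G2 normrM -[leRHS]mul1r ler_pM//; exact: normr_G1_le1.
Qed.

(** The derivative is bounded uniformly over the b for which the probability of
    selection stays above delta, since it enters the pivot as a divisor. *)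
Lemma is_derive_G2 b : 0 < delta -> delta <= sel_mass rho b ->
  exists2 dG : R -> R, forall z : R, is_derive z 1 (fun z => G2 rho H z b) (dG z) &
    forall z, `|dG z| <= M * (normal_peak 1 / rho + normal_peak 1 / delta).
Proof.
move=> delta0 delta_le.
have M0 : 0 <= M by exact: le_trans (HM 0).
exists (fun z => phi (- (z + b) / rho) / rho * H (pivot rho z b) +
  G1 rho z b * (dH (pivot rho z b) * (- (phi z * G1 rho z b) / sel_mass rho b))).
  move=> z; have ? := is_derive_G1 rho z b; have ? := is_derive_pivot rho z b.
  have ? := HE (pivot rho z b).
  have -> : (fun z => G2 rho H z b) =
      (fun z => G1 rho z b) * (H \o (fun z => pivot rho z b)) by [].
  apply: is_derive_eq; rewrite /GRing.scale/=; ring.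
move=> z; apply: le_trans (ler_normD _ _) _; rewrite [leRHS]mulrDr lerD//.
  by rewrite mulrC normrM ler_pM// normr_dG1_le.
rewrite normrM -[leRHS]mul1r ler_pM ?normr_G1_le1// normrM ler_pM//.
rewrite mulNr normrN normrM normfV (gtr0_norm (sel_mass_gt0 rho b)).
apply: ler_pM => //; first by rewrite invr_ge0 (ltW (sel_mass_gt0 rho b)).
  rewrite normrM -[leRHS]mulr1 ler_pM ?normr_G1_le1//.
  by rewrite ger0_norm ?normal_pdf_ge0 ?phi_le_peak.
by rewrite lef_pV2 ?posrE ?sel_mass_gt0.
Qed.

End weighted_test_function.

Lemma C3_bounded_lipschitz H : C3_bounded H -> exists M : R, exists dH : R -> R,
  [/\ forall x : R, is_derive x 1 H (dH x), forall x, `|H x| <= M &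
      forall x, `|dH x| <= M].
Proof.
move=> [dH _ [M HM]]; exists M, (H^`())%classic; split.
- by move=> x; rewrite derive1E; apply/derivableP; exact: (dH 0%N).
- exact: (HM 0%N).
- exact: (HM 1%N).
Qed.

End selection_weight.

(** * From one observation to the standardized sample mean *)

Section same_law.
Context d d' (Om : measurableType d) (T : measurableType d') (R : realType).
Variables (Q : probability Om R) (P : probability T R) (X : {mfun Om >-> T}).
Hypothesis lawX : forall A, measurable A -> Q (X @^-1` A) = P A.

Lemma same_law_Rintegral (g : T -> R) : P.-integrable setT (EFin \o g) ->
  Q.-integrable setT (EFin \o (g \o X)) /\ \int[Q]_w g (X w) = \int[P]_x g x.
Proof.
move=> ig; have mg := measurable_int _ ig.
have lawE (f : T -> \bar R) : (\int[distribution Q X]_x f x = \int[P]_x f x)%E.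
  by apply: eq_measure_integral => A mA _; exact: lawX.
have igX : Q.-integrable setT (EFin \o (g \o X)).
  apply/integrableP; split; first exact: (measurableT_comp mg).
  rewrite -(@ge0_integral_distribution _ _ _ _ _ Q X (fun x => `|(g x)%:E|%E))//.
    by rewrite lawE; have /integrableP[] := ig.
  exact: measurableT_comp.
split=> //; rewrite /Rintegral; congr fine.
by rewrite -lawE (integral_distribution mg).
Qed.

End same_law.

Section standardized_component.
Context {R : realType} {d : nat} (P : probability (Rvec R d) R) (j : 'I_d).
Hypothesis covI : identity_covariance P.

Let e (x : Rvec R d) : R := component j x - mean P j.

Let measurable_component : @measurable_fun _ _ (Rvec R d) R setT (component j).
Proof. exact: measurable_tnth. Qed.

Let integrable_component : P.-integrable setT (EFin \o component j).
Proof.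
apply/Lfun1_integrable; apply: (Lfun_subset12 _ (covI.1 j)).
exact: fin_num_measure.
Qed.

Let integrable_mean : P.-integrable setT (EFin \o cst (mean P j)).
Proof. exact: (@bounded_integrable _ _ _ P (cst (mean P j)) `|mean P j|). Qed.

Lemma measurable_error : @measurable_fun _ _ (Rvec R d) R setT e.
Proof. exact: measurable_funB. Qed.

Lemma integrable_error : P.-integrable setT (EFin \o e).
Proof.
exact: (integrableB measurableT integrable_component integrable_mean).
Qed.

Lemma Rintegral_error : \int[P]_x e x = 0.
Proof.
rewrite (RintegralB measurableT integrable_component integrable_mean).
rewrite Rintegral_cst// [X in fine X](_ : _ = 1%E); last exact: probability_setT.
by rewrite mulr1 /mean unlock subrr.
Qed.

Let integral_error2 : (\int[P]_x (e x ^+ 2)%:E = 1)%E.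
Proof.
have := covI.2 j j; rewrite eqxx unlock unlock => E; rewrite -[RHS]E.
by apply: eq_integral => x _; rewrite /e /mean unlock expr2.
Qed.

Lemma integrable_error2 : P.-integrable setT (EFin \o (fun x => e x ^+ 2)).
Proof.
apply/integrableP; split.
  by apply/measurable_EFinP; apply: measurable_funX; exact: measurable_error.
under eq_integral do rewrite /= ger0_norm ?sqr_ge0//.
by rewrite integral_error2 ltry.
Qed.

Lemma Rintegral_error2 : \int[P]_x e x ^+ 2 = 1.
Proof. by rewrite /Rintegral integral_error2. Qed.

Lemma integrable_error3 (m3 : R) : (third_moment P j <= m3%:E)%E ->
  P.-integrable setT (EFin \o (fun x => `|e x| ^+ 3)) /\
  \int[P]_x `|e x| ^+ 3 <= m3.
Proof.
move=> le_m3; have i3 : P.-integrable setT (EFin \o (fun x => `|e x| ^+ 3)).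
  apply/integrableP; split.
    apply/measurable_EFinP; apply: measurable_funX; apply: measurableT_comp => //.
    exact: measurable_error.
  under eq_integral do rewrite /= ger0_norm ?exprn_ge0//.
  by rewrite (le_lt_trans le_m3)// ltry.
split=> //; rewrite -lee_fin fineK//; exact: integrable_fin_num i3.
Qed.

End standardized_component.

Section sample.
Context {R : realType} {d : nat} (j : 'I_d) {dO : measure_display}.
Context {Om : measurableType dO} (Q : probability Om R).
Context (P : probability (Rvec R d) R).
Context (n : nat) (zeta : 'I_n -> {mfun Om >-> Rvec R d}) (m3 : R).
Hypotheses (iid : iid_sample Q zeta P) (covI : identity_covariance P).
Hypothesis le_m3 : (third_moment P j <= m3%:E)%E.

Let s := (Num.sqrt (n%:R : R))^-1.
Let g (x : Rvec R d) : R := s * (component j x - mean P j).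

Let measurable_g : @measurable_fun _ _ (Rvec R d) R setT g.
Proof. by apply: measurable_funM => //; exact: measurable_error. Qed.

Let X i w := g (zeta i w).

Lemma measurable_summand i : measurable_fun setT (X i).
Proof. exact: measurableT_comp. Qed.

Lemma tnth_Z w : tnth (Z_ zeta (mean P) w) j = \sum_i X i w.
Proof. by rewrite tnth_mktuple. Qed.

Lemma measurable_tnth_Z :
  measurable_fun setT (fun w => tnth (Z_ zeta (mean P) w) j : R).
Proof.
rewrite (_ : (fun w => _) = (fun w => \sum_i X i w)).
  exact: (measurable_sum _ measurable_summand).
by apply/funext => w; rewrite tnth_Z.
Qed.

Lemma indep_summand : indep_family Q X.
Proof.
move=> J A mA; apply: (iid.2 J (fun i => g @^-1` A i)) => i.
by rewrite -[X in measurable X]setTI; exact: measurable_g.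
Qed.

Lemma sample_moments :
  [/\ forall i, Q.-integrable setT (EFin \o (fun w => `|X i w| ^+ 3)),
      forall i, \int[Q]_w X i w = 0,
      forall i, \int[Q]_w X i w ^+ 2 = s ^+ 2 &
      forall i, \int[Q]_w `|X i w| ^+ 3 <= s ^+ 3 * m3].
Proof.
have s0 : 0 <= s by rewrite invr_ge0.
pose e (x : Rvec R d) : R := component j x - mean P j.
have [i3 le3] := integrable_error3 le_m3.
have law i := same_law_Rintegral (iid.1 i).
have X3 i w : `|X i w| ^+ 3 = s ^+ 3 * `|e (zeta i w)| ^+ 3.
  by rewrite /X /g normrM (ger0_norm s0) exprMn.
split=> i.
- have [i3Q _] := law i _ i3.
  have := @integrableZl _ _ _ Q _ measurableT (s ^+ 3) _ i3Q.
  by apply: eq_integrable => // w _; rewrite /= X3.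
- have [iQ E] := law i _ (integrable_error j covI).
  by rewrite /X /g (RintegralZl s measurableT iQ) E (Rintegral_error j covI) mulr0.
- have [iQ E] := law i _ (integrable_error2 j covI).
  under eq_Rintegral do rewrite /X /g exprMn.
  by rewrite (RintegralZl (s ^+ 2) measurableT iQ) E (Rintegral_error2 j covI) mulr1.
- have [iQ E] := law i _ i3.
  under eq_Rintegral do rewrite X3.
  by rewrite (RintegralZl (s ^+ 3) measurableT iQ) E ler_wpM2l ?exprn_ge0.
Qed.

End sample.

Lemma sample_rate (R : realType) (M L : R) : exists2 C : R, 0 <= C &
  forall d (j : 'I_d) dO (Om : measurableType dO) (Q : probability Om R)
    (P : probability (Rvec R d) R) n (zeta : 'I_n -> {mfun Om >-> Rvec R d})
    (m3 : R) (h dh : R -> R),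
  (0 < n)%N -> iid_sample Q zeta P -> identity_covariance P ->
  (third_moment P j <= m3%:E)%E ->
  (forall x : R, is_derive x 1 h (dh x)) ->
  (forall x, `|h x| <= M) -> (forall x, `|dh x| <= L) ->
  `|\int[Q]_w h (tnth (Z_ zeta (mean P) w) j) -
    \int[std_gaussian R d]_z h (tnth z j)| <= C * (2 * m3 + 1) / Num.sqrt n%:R.
Proof.
have [C C0 rate] := clt_rate M L; exists C => //.
move=> d j dO Om Q P n zeta m3 h dh n0 iid covI le_m3 hE hM dhL.
rewrite (integral_marginal (normal_prob 0 1) j (is_derive_measurable hE) hM).
have [X3 EX EX2 EX3] := sample_moments iid covI le_m3.
under eq_Rintegral do rewrite tnth_Z.
exact: rate n0 erefl (measurable_summand j P zeta) (indep_summand j iid)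
  X3 EX EX2 EX3 hE hM dhL.
Qed.

(** * Uniform convergence of the remainders *)

Lemma cvg_rsqrt (R : realType) (A : R) :
  (A / Num.sqrt n%:R)%:E @[n --> \oo] --> 0%E.
Proof.
apply: cvg_EFin; first by near=> n.
rewrite -[X in _ --> X](mulr0 A); apply: cvgMr.
rewrite (_ : (fun n => _) = Num.sqrt \o (fun n => n%:R^-1)); last first.
  by apply/funext => n; rewrite /= sqrtrV.
rewrite -[X in _ --> X](sqrtr0 R).
apply: continuous_cvg; first exact: sqrt_continuous.
by rewrite -cvg_shiftS; exact: cvg_harmonic.
Unshelve. all: by end_near. Qed.

Lemma sup_nneg_cvg0 (R : realType) (T : Type) (S : nat -> set T)
    (f : nat -> T -> R) (A : R) :
  (forall n t, (0 < n)%N -> S n t -> f n t <= A / Num.sqrt n%:R) -> 0 <= A ->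
  sup_nneg [set (f n t)%:E | t in S n] @[n --> \oo] --> 0%E.
Proof.
move=> fA A0; apply: (@squeeze_cvge _ _ _ _ (cst 0%E) _
  (fun n => (A / Num.sqrt n%:R)%:E)).
- near=> n; apply/andP; split; first by apply: ereal_sup_ubound; right.
  have n0 : (0 < n)%N by near: n; exact: nbhs_infty_gt.
  apply: ge_ereal_sup => _ [[t St <-]|->]; first by rewrite lee_fin fA.
  by rewrite lee_fin divr_ge0.
- exact: cvg_cst.
- exact: cvg_rsqrt.
Unshelve. all: by end_near. Qed.

(** Numerator and denominator are replaced one at a time:
    a / b - a' / b' = (a - a') / b' - (a / b) (b - b') / b'. As |a / b| <= M,
    the bound degrades only when b' is small, not when b is. The identity
    persists for b = 0, where a = 0 and a / b = 0 by convention. *)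
Lemma ratio_discrepancy (R : realFieldType) (a b a' b' M : R) :
  0 <= b -> 0 < b' -> 0 <= M -> `|a| <= M * b ->
  `|a / b - a' / b'| <= b'^-1 * `|a - a'| + M * (b'^-1 * `|b - b'|).
Proof.
move=> b0 b'0 M0 aM.
have abM : `|a / b| <= M.
  have [->|bn0] := eqVneq b 0; first by rewrite invr0 mulr0 normr0.
  have {}b0 : 0 < b by rewrite lt_neqAle eq_sym bn0.
  by rewrite normrM normfV (gtr0_norm b0) ler_pdivrMr.
have b'n0 : b' != 0 by rewrite gt_eqF.
have E : a / b - a' / b' = b'^-1 * (a - a') - (a / b) * (b'^-1 * (b - b')).
  have [bE|bn0] := eqVneq b 0; last by field; rewrite bn0 b'n0.
  have -> : a = 0 by apply/eqP; rewrite -normr_le0; move: aM; rewrite bE mulr0.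
  by rewrite bE invr0; field.
have V0 : 0 <= b'^-1 by rewrite invr_ge0 ltW.
rewrite E; apply: le_trans (ler_normB _ _) _.
rewrite (normrM b'^-1) (normrM (a / b)) (normrM b'^-1) (ger0_norm V0).
by rewrite lerD2l ler_wpM2r// mulr_ge0.
Qed.

Lemma cond_discrepancy_le (R : realType) d (j : 'I_d) dO (Om : measurableType dO)
    (Q : probability Om R) (Z : Om -> Rvec R d) (rho b M : R) (H dH : R -> R) :
  0 < rho -> measurable_fun setT (fun w => tnth (Z w) j : R) ->
  (forall x : R, is_derive x 1 H (dH x)) ->
  (forall x, `|H x| <= M) -> (forall x, `|dH x| <= M) ->
  cond_discrepancy j rho Q Z b H <=
    remainder j rho Q Z b (G2 rho H) + M * remainder j rho Q Z b (G1 rho).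
Proof.
move=> rho0 mZ HE HM dHM.
have M0 : 0 <= M by exact: le_trans (HM 0).
have [dG GE _] := is_derive_G2 rho0 HE HM dHM (sel_mass_gt0 rho b) (lexx _).
have i1 : Q.-integrable setT (EFin \o (fun w => G1 rho (tnth (Z w) j) b)).
  apply: (@bounded_integrable _ _ _ Q _ 1) => [|w]; last exact: normr_G1_le1.
  exact: measurableT_comp (measurable_G1 rho b) mZ.
have i2 : Q.-integrable setT (EFin \o (fun w => G2 rho H (tnth (Z w) j) b)).
  apply: (@bounded_integrable _ _ _ Q _ M) => [|w]; last exact: normr_G2_le.
  exact: measurableT_comp (is_derive_measurable GE) mZ.
have weightE dT (T : measurableType dT) (mu : {measure set T -> \bar R})
    (z : T -> Rvec R d) :
    \int[mu]_w (H (pivot rho (tnth (z w) j) b) *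
      Phibar (- (tnth (z w) j + b) / rho)) =
    \int[mu]_w G2 rho H (tnth (z w) j) b.
  by apply: eq_Rintegral => w _; rewrite /G2 mulrC.
rewrite /cond_discrepancy /cond_expectation /remainder !weightE.
apply: ratio_discrepancy => //.
- by apply: Rintegral_ge0 => w _; exact/ltW/G1_gt0.
- by rewrite -/(D_ j rho b) D_sel_mass sel_mass_gt0.
- apply: le_trans (le_normr_Rintegral measurableT i2) _.
  rewrite -(RintegralZl M measurableT i1); apply: le_Rintegral => //.
  + exact: integrable_norm.
  + exact: (@integrableZl _ _ _ Q _ measurableT M _ i1).
  + move=> w _; rewrite /G2 normrM mulrC ler_pM//.
    by rewrite gtr0_norm// Phibar_gt0.
Qed.

Theorem theorem1 (R : realType) (d : nat) (j : 'I_d)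
  (rho : R) (rho_gt0 : 0 < rho) (rho_lt1 : rho < 1)
  (H : R -> R) (HC3 : C3_bounded H)
  (dO : measure_display) (Om : nat -> measurableType dO)
  (zeta : forall n : nat, 'I_n -> {mfun Om n >-> Rvec R d})
  (Pr : forall n : nat, probability (Rvec R d) R -> probability (Om n) R)
  (Pb : forall n : nat, set (probability (Rvec R d) R))
  (iid : forall n P, (0 < n)%N -> Pb n P -> iid_sample (Pr n P) (zeta n) P)
  (covI : forall n P, (0 < n)%N -> Pb n P -> identity_covariance P)
  (dens : forall n P, (0 < n)%N -> Pb n P ->
    has_lebesgue_density (Pr n P) (V_ (zeta n)))
  (r : R) (r_gt0 : 0 < r)
  (bounded_means : forall n P, (0 < n)%N -> Pb n P ->
    forall k : 'I_d, `|Num.sqrt n%:R * mean P k| < r)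
  (bounded_third_moments :
    (ereal_sup [set ereal_sup [set third_moment P j | P in Pb n]
               | n in [set n | (0 < n)%N]] < +oo)%E) :
  let Z n P := Z_ (zeta n) (mean P) in
  let b n P := Num.sqrt n%:R * mean P j in
  [/\ sup_nneg [set (remainder j rho (Pr n P) (Z n P) (b n P) (G1 rho))%:E
               | P in Pb n] @[n --> \oo] --> 0%E,
      sup_nneg [set (remainder j rho (Pr n P) (Z n P) (b n P) (G2 rho H))%:E
               | P in Pb n] @[n --> \oo] --> 0%E &
      sup_nneg [set (cond_discrepancy j rho (Pr n P) (Z n P) (b n P) H)%:E
               | P in Pb n] @[n --> \oo] --> 0%E].
Proof.
move=> Z b.
(* The supremum is -oo when there is no law at all; then any m3 will do. *)
have [m3 m30 le_m3] : exists2 m3 : R, 0 <= m3 &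
    forall n P, (0 < n)%N -> Pb n P -> (third_moment P j <= m3%:E)%E.
  set u := ereal_sup _ in bounded_third_moments.
  have uP n P : (0 < n)%N -> Pb n P -> (third_moment P j <= u)%E.
    move=> n0 PbP.
    apply: (@le_trans _ _ (ereal_sup [set third_moment P j | P in Pb n])).
      by apply: ereal_sup_ubound; exists P.
    by apply: ereal_sup_ubound; exists n.
  move: u bounded_third_moments uP => [u _ uP|//|_ uP].
    exists `|u| => // n P n0 PbP.
    by rewrite (le_trans (uP _ _ n0 PbP))// lee_fin ler_norm.
  by exists 0 => // n P n0 PbP; apply: le_trans (uP _ _ n0 PbP) (leNye _).
have [M [dH [HE HM dHM]]] := C3_bounded_lipschitz HC3.
have M0 : 0 <= M by exact: le_trans (HM 0).
(* The probability of selection increases with b, and b > - r. *)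
pose delta := sel_mass rho (- r).
have delta0 : 0 < delta by exact: sel_mass_gt0.
have mass_ge n P : (0 < n)%N -> Pb n P -> delta <= sel_mass rho (b n P).
  move=> n0 PbP; apply: sel_mass_nondecreasing => //.
  by have := bounded_means n P n0 PbP j; rewrite ltr_norml => /andP[/ltW].
have [C1 C10 rate1] := sample_rate 1 (normal_peak 1 / rho).
have [C2 C20 rate2] :=
  sample_rate M (M * (normal_peak 1 / rho + normal_peak 1 / delta)).
pose A1 := delta^-1 * (C1 * (2 * m3 + 1)).
pose A2 := delta^-1 * (C2 * (2 * m3 + 1)).
have A10 : 0 <= A1.
  by rewrite mulr_ge0 ?invr_ge0 ?(ltW delta0)// mulr_ge0// addr_ge0// mulr_ge0.
have A20 : 0 <= A2.
  by rewrite mulr_ge0 ?invr_ge0 ?(ltW delta0)// mulr_ge0// addr_ge0// mulr_ge0.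
have mass_scale n P C x : (0 < n)%N -> Pb n P ->
    x <= C / Num.sqrt n%:R -> 0 <= x ->
    (D_ j rho (b n P))^-1 * x <= delta^-1 * C / Num.sqrt n%:R.
  move=> n0 PbP xC x0; rewrite -mulrA; apply: ler_pM => //.
    by rewrite invr_ge0 D_sel_mass (ltW (sel_mass_gt0 _ _)).
  by rewrite D_sel_mass lef_pV2 ?posrE ?sel_mass_gt0//; exact: mass_ge n0 PbP.
have R1 n P : (0 < n)%N -> Pb n P ->
    remainder j rho (Pr n P) (Z n P) (b n P) (G1 rho) <= A1 / Num.sqrt n%:R.
  move=> n0 PbP; apply: mass_scale => //.
  apply: (rate1 _ _ _ _ _ _ _ _ _ _ _ n0 (iid n P n0 PbP) (covI n P n0 PbP)
    (le_m3 n P n0 PbP) (fun z => is_derive_G1 rho z (b n P))).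
  - by move=> z; exact: normr_G1_le1.
  - by move=> z; exact: normr_dG1_le.
have R2 n P : (0 < n)%N -> Pb n P ->
    remainder j rho (Pr n P) (Z n P) (b n P) (G2 rho H) <= A2 / Num.sqrt n%:R.
  move=> n0 PbP; apply: mass_scale => //.
  have [dG GE dGM] := is_derive_G2 rho_gt0 HE HM dHM delta0 (mass_ge n P n0 PbP).
  apply: (rate2 _ _ _ _ _ _ _ _ _ _ _ n0 (iid n P n0 PbP) (covI n P n0 PbP)
    (le_m3 n P n0 PbP) GE) => //.
  by move=> z; exact: normr_G2_le.
have R3 n P : (0 < n)%N -> Pb n P ->
    cond_discrepancy j rho (Pr n P) (Z n P) (b n P) H <=
    (A2 + M * A1) / Num.sqrt n%:R.
  move=> n0 PbP.
  have mZ : measurable_fun setT (fun w => tnth (Z n P w) j : R).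
    exact: measurable_tnth_Z.
  apply: le_trans (cond_discrepancy_le (Pr n P) (b n P) rho_gt0 mZ HE HM dHM) _.
  by rewrite [leRHS]mulrDl -(mulrA M A1) lerD ?R2// ler_wpM2l// R1.
split.
- exact: sup_nneg_cvg0 R1 A10.
- exact: sup_nneg_cvg0 R2 A20.
- by apply: sup_nneg_cvg0 R3 _; rewrite addr_ge0// mulr_ge0.
Qed.
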